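(* Let $i_1,\dots,i_m\in\mathcal{C}l_{0,m}$ with $i_k^2=-1$, $0\le\mu\le m$, and let $\tau^{F_1,F_2}_y$ be the generalized translation defined in the context. Let $J$ be the set of arrays $\vec j=(j_{\nu,k})\in\{0,1\}^{4\times m}$ with $j_{1,k}+j_{2,k}+j_{3,k}\in\{0,2\}$ and $j_{4,k}=0$ for all $k$. Then \[ \tau^{F_1,F_2}_yf(x)=\frac{1}{4^m}\sum_{\vec j\in J}\sum_{\vec\phi,\vec\gamma\in\{0,1\}^m}c_{\vec j,\vec\phi,\vec\gamma}\prod_{k=\mu}^{1}(i_k)^{j_{1,k}}\prod_{k=1}^{\mu}(-i_k)^{j_{2,k}}\prod_{k=1}^{\mu}(-i_k)^{j_{3,k}}\;\tau_{y^{\vec\phi}}f^{\vec\gamma}(x)\;\prod_{k=\mu+1}^{m}(-i_k)^{j_{3,k}}\prod_{k=\mu+1}^{m}(-i_k)^{j_{2,k}}\prod_{k=m}^{\mu+1}(i_k)^{j_{1,k}}, \] where $\tau_{y^{\vec\phi}}f^{\vec\gamma}(x)=f^{\vec\gamma}(x-y^{\vec\phi})$, $y^{\vec\phi}=((-1)^{\phi_1}y_1,\dots,(-1)^{\phi_m}y_m)$, and $c_{\vec j,\vec\phi,\vec\gamma}=\prod_{k=1}^m(-1)^{(j_{(2\phi_k+\gamma_k+1,k)}+1)(\delta_{(j_{1,k}+j_{2,k}+j_{3,k})}-1)}$ with $\delta_{(\ell)}=1$ if $\ell=0$ and $0$ otherwise.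
   Context: $\mathcal{C}l_{0,m}$ is the real associative algebra generated by $e_1,\dots,e_m$ with $e_ie_j+e_je_i=0$ ($i\ne j$), $e_i^2=-1$; $f:\mathbb{R}^m\to\mathcal{C}l_{0,m}$ is such that all integrals below make sense. $F_1=\{i_1,\dots,i_\mu\}$, $F_2=\{i_{\mu+1},\dots,i_m\}$. $\prod_{k=a}^{b}$ with $a\le b$ is the ordered product in increasing $k$; $\prod_{k=b}^{a}$ is the product in decreasing order of $k$. The geometric Fourier transform is $\mathcal{F}_{F_1,F_2}(f)(u)=(2\pi)^{-m/2}\int_{\mathbb{R}^m}\prod_{k=1}^{\mu}e^{-i_kx_ku_k}\,f(x)\prod_{k=\mu+1}^{m}e^{-i_kx_ku_k}\,dx$ (invertible, with inverse $\mathcal{F}^{-1}_{F_1,F_2}(h)(x)=(2\pi)^{-m/2}\int\prod_{k=\mu}^{1}e^{i_kx_ku_k}h(u)\prod_{k=m}^{\mu+1}e^{i_kx_ku_k}du$). The generalized translation $\tau^{F_1,F_2}_y$ is defined by $\mathcal{F}_{F_1,F_2}(\tau^{F_1,F_2}_yf)(u)=\left(\prod_{k=1}^{\mu}e^{-i_ky_ku_k}\right)\mathcal{F}_{F_1,F_2}(f)(u)\left(\prod_{k=\mu+1}^{m}e^{-i_ky_ku_k}\right)$. For $\vec\gamma\in\{0,1\}^m$, $f^{\vec\gamma}(x)=f((-1)^{\gamma_1}x_1,\dots,(-1)^{\gamma_m}x_m)$. *)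

(* Defs.v *)
From HB Require Import structures.
From mathcomp Require Import all_boot all_order all_algebra.
From mathcomp Require Import all_classical all_reals all_analysis.
Import numFieldNormedType.Exports.
Set Implicit Arguments.
Unset Strict Implicit.
Unset Printing Implicit Defensive.
Import Order.TTheory GRing.Theory Num.Theory.
Local Open Scope ring_scope.

(* Lebesgue measure on R^m, built as the iterated product measure       *)
(*   lambda \x (lambda \x ( ... \x (dirac tt)))                        *)
(* on R * (R * ( ... * unit)) (m factors R).                            *)
(* The library only declares the sigma-finiteness of m1 \x m2 non-      *)
(* canonically, so we copy it onto an alias [sfprod].                   *)
Section sfprod.
Local Open Scope classical_set_scope.
Local Open Scope ereal_scope.
Context d1 d2 (T1 : measurableType d1) (T2 : measurableType d2) (R : realType).
Variable m1 : {sigma_finite_measure set T1 -> \bar R}.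
Variable m2 : {sigma_finite_measure set T2 -> \bar R}.
Definition sfprod := (m1 \x m2).
HB.instance Definition _ := Measure.on sfprod.
Lemma sfprod_sigma_finite : sigma_finite setT sfprod.
Proof.
have /sigma_finiteP[F [TF ndF Foo]] := sigma_finiteT m1.
have /sigma_finiteP[G [TG ndG Goo]] := sigma_finiteT m2.
exists (fun n => F n `*` G n).
 rewrite -setXTT TF TG predeqE => -[x y]; split.
    move=> [/= [n _ Fnx] [k _ Gky]]; exists (maxn n k) => //; split.
    - by move: x Fnx; exact/subsetPset/ndF/leq_maxl.
    - by move: y Gky; exact/subsetPset/ndG/leq_maxr.
  by move=> [n _ []/= ? ?]; split; exists n.
move=> k; have [? ?] := Foo k; have [? ?] := Goo k.
split; first exact: measurableX.
by rewrite /sfprod product_measure1E// lte_mul_pinfty// ge0_fin_numE.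
Qed.
HB.instance Definition _ := Measure_isSigmaFinite.Build _ _ _ sfprod
  sfprod_sigma_finite.
End sfprod.

Record mspace (R : realType) := MSpace {
  ms_disp : measure_display;
  ms_type : measurableType ms_disp;
  ms_mu : {sigma_finite_measure set ms_type -> \bar R} }.

Fixpoint lebRn (R : realType) (n : nat) : mspace R :=
  match n with
  | 0 => @MSpace R _ unit (@dirac _ unit tt R)
  | n'.+1 => @MSpace R _ _ (sfprod (@lebesgue_measure R) (ms_mu (lebRn R n')))
  end.
Fixpoint Rn_coord (R : realType) (n : nat) : ms_type (lebRn R n) -> nat -> R :=
  match n return ms_type (lebRn R n) -> nat -> R with
  | 0 => fun _ _ => 0
  | n'.+1 => fun p k => match k with 0 => p.1 | k'.+1 => @Rn_coord R n' p.2 k' end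
  end.

Definition Rm_pt (R : realType) (m : nat) (p : ms_type (lebRn R m)) : 'rV[R]_m :=
  \row_(k < m) Rn_coord p k.

(* The Clifford algebra Cl_{0,m}: coordinates on the blade basis e_A,   *)
(* A a subset of {1..m} (here {0..m-1}); e_A = e_{a1} ... e_{ak} with   *)
(* a1 < ... < ak.  Multiplication of blades:                            *)
(*   e_A e_B = (-1)^(#{(a,b) in AxB | b < a} + #|A :&: B|) e_(A Δ B)    *)
(* which is the multiplication determined by e_i e_j = - e_j e_i        *)
(* (i <> j) and e_i^2 = -1.                                              *)
Notation Cl R m := ({ffun {set 'I_m} -> R}) (only parsing).

Section Clifford.
Variables (R : realType) (m : nat).

Definition clbasis (A : {set 'I_m}) : Cl R m := [ffun B => ((B == A)%:R : R)].
Definition clone : Cl R m := clbasis (finset.set0 : {set 'I_m}).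

Definition clsign (A B : {set 'I_m}) : R :=
  (-1) ^+ (#|[set p : 'I_m * 'I_m | [&& p.1 \in A, p.2 \in B & (p.2 < p.1)%N]]|
           + #|A :&: B|).

Definition clmul (x y : Cl R m) : Cl R m :=
  \sum_(A : {set 'I_m}) \sum_(B : {set 'I_m})
     (x A * y B * clsign A B) *: clbasis ((A :\: B) :|: (B :\: A)).

Definition clprod (s : seq (Cl R m)) : Cl R m := foldr clmul clone s.

(* e^{v theta} for v with v^2 = -1:  cos theta + v sin theta *)
Definition clexp (v : Cl R m) (theta : R) : Cl R m :=
  cos theta *: clone + sin theta *: v.

Definition clpow (v : Cl R m) (b : bool) : Cl R m := if b then v else clone.

Definition clint (g : 'rV[R]_m -> Cl R m) : Cl R m :=
  [ffun A => Rintegral (ms_mu (lebRn R m)) setT (fun p => g (Rm_pt p) A)].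

Definition cl_integrable (g : 'rV[R]_m -> Cl R m) : Prop :=
  forall A, (ms_mu (lebRn R m)).-integrable setT (fun p => (g (Rm_pt p) A)%:E).

(* Geometric Fourier transform F_{F1,F2}, its inverse, the generalized  *)
(* translation.  Index k : 'I_m stands for k+1; F1 = {i_1..i_mu},      *)
(* F2 = {i_(mu+1)..i_m}.                                                *)
Variables (i : 'I_m -> Cl R m) (mu : nat).

Definition idxF1 : seq 'I_m := [seq k : 'I_m <- enum 'I_m | (nat_of_ord k < mu)%N].
Definition idxF2 : seq 'I_m := [seq k : 'I_m <- enum 'I_m | (mu <= nat_of_ord k)%N].

Definition cl_nrm : R := (Num.sqrt (2 * pi))^-1 ^+ m.

Definition expprod (s : seq 'I_m) (sg : R) (x u : 'rV[R]_m) : Cl R m :=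
  clprod [seq clexp (i k) (sg * (x 0 k * u 0 k)) | k <- s].

Definition GFT (f : 'rV[R]_m -> Cl R m) (u : 'rV[R]_m) : Cl R m :=
  cl_nrm *: clint (fun x =>
    clmul (clmul (expprod idxF1 (-1) x u) (f x)) (expprod idxF2 (-1) x u)).

Definition IGFT (h : 'rV[R]_m -> Cl R m) (x : 'rV[R]_m) : Cl R m :=
  cl_nrm *: clint (fun u =>
    clmul (clmul (expprod (rev idxF1) 1 x u) (h u)) (expprod (rev idxF2) 1 x u)).

Definition gtrans (y : 'rV[R]_m) (f : 'rV[R]_m -> Cl R m) : 'rV[R]_m -> Cl R m :=
  IGFT (fun u =>
    clmul (clmul (expprod idxF1 (-1) y u) (GFT f u)) (expprod idxF2 (-1) y u)).

Definition crefl (phi : {ffun 'I_m -> bool}) (x : 'rV[R]_m) : 'rV[R]_m :=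
  \row_k ((-1) ^+ phi k * x 0 k).

(* j_{nu,k} with nu in {1,2,3,4} (1-based, as in the paper) *)
Definition jent (j : {ffun 'I_4 * 'I_m -> bool}) (nu : nat) (k : 'I_m) : bool :=
  j (inord nu.-1, k).

Definition jsum (j : {ffun 'I_4 * 'I_m -> bool}) (k : 'I_m) : nat :=
  (jent j 1 k + jent j 2 k + jent j 3 k)%N.

Definition inJ (j : {ffun 'I_4 * 'I_m -> bool}) : bool :=
  [forall k, (jsum j k \in [:: 0%N; 2%N]) && ~~ jent j 4 k].

Definition kdelta (l : nat) : nat := if l == 0%N then 1%N else 0%N.

Definition ccoef (j : {ffun 'I_4 * 'I_m -> bool}) (phi gam : {ffun 'I_m -> bool}) : R :=
  \prod_(k < m) (-1) ^ (((jent j (2 * phi k + gam k + 1)%N k)%:Z + 1)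
                         * ((kdelta (jsum j k))%:Z - 1)).

Definition lfactor (j : {ffun 'I_4 * 'I_m -> bool}) : Cl R m :=
  clmul (clmul (clprod [seq clpow (i k) (jent j 1 k) | k <- rev idxF1])
               (clprod [seq clpow (- i k) (jent j 2 k) | k <- idxF1]))
        (clprod [seq clpow (- i k) (jent j 3 k) | k <- idxF1]).

Definition rfactor (j : {ffun 'I_4 * 'I_m -> bool}) : Cl R m :=
  clmul (clmul (clprod [seq clpow (- i k) (jent j 3 k) | k <- idxF2])
               (clprod [seq clpow (- i k) (jent j 2 k) | k <- idxF2]))
        (clprod [seq clpow (i k) (jent j 1 k) | k <- rev idxF2]).

End Clifford.

(* Main.v *)
(** The integrand of the inverse transform is a product of three families of
    factors [cos +- sin i_k], one for each of [x], [y], and the integration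
    variable [z] of the forward transform.  Expanding all of them yields a sum over the arrays [j] of
    [prod_k t(x_k u_k) t(y_k u_k) t(z_k u_k)] ([t] = cos or sin according to [j])
    times [lfactor j * f z * rfactor j].

    The [u]-integral is regularized by [prod_k exp(- u_k^2 / 4N)], so that it may
    be exchanged with the [z]-integral.  In dimension one, product-to-sum formulas
    and the Fourier transform of the Gaussian turn the [u]-integral into [0] when
    the number of sines is odd, and otherwise into a signed sum of four Gaussians
    of variance [1 / 2N] centred at [(-1)^gam (x_k - (-1)^phi y_k)].  Their products
    are approximate identities, so [N -> oo] produces the values of [f] at the
    points [crefl gam (x - crefl phi y)].  As [f] need not be bounded, the
    faster-than-polynomial decay of the Gaussian is what controls the tails. *)
Require Import Defs.
From HB Require Import structures.
From mathcomp Require Import all_boot all_order all_algebra.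
From mathcomp Require Import all_classical all_reals all_analysis.
From mathcomp Require Import measurable_realfun ring lra.
Import numFieldNormedType.Exports.
Set Implicit Arguments.
Unset Strict Implicit.
Unset Printing Implicit Defensive.
Import Order.TTheory GRing.Theory Num.Theory.
Local Open Scope ring_scope.

(** * The Clifford algebra *)

Section CliffordAlgebra.
Variables (R : realType) (m : nat).
Local Notation Cl := {ffun {set 'I_m} -> R}.
Local Notation "x ** y" := (clmul x y) (at level 40, left associativity).
Local Notation symd A B := ((A :\: B) :|: (B :\: A))%SET.

Lemma in_symd (A B : {set 'I_m}) k :
  (k \in symd A B) = (k \in A) (+) (k \in B).
Proof. by rewrite !inE; case: (k \in A); case: (k \in B). Qed.

Lemma symdA (A B C : {set 'I_m}) : symd A (symd B C) = symd (symd A B) C.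
Proof. by apply/setP => k; rewrite !in_symd addbA. Qed.

Lemma sym0d (A : {set 'I_m}) : symd finset.set0 A = A.
Proof. by apply/setP => k; rewrite in_symd inE. Qed.

Lemma symd0 (A : {set 'I_m}) : symd A finset.set0 = A.
Proof. by apply/setP => k; rewrite in_symd inE addbF. Qed.

(** The diagonal pairs stand for [A :&: B], so the two counts in [clsign] merge by replacing [<]
    with [<=], and the sign then splits over pairs. *)
Lemma clsignE (A B : {set 'I_m}) : clsign R A B =
  \prod_(p : 'I_m * 'I_m) (-1) ^+ [&& p.1 \in A, p.2 \in B & (p.2 <= p.1)%N].
Proof.
rewrite prodrXr; congr (_ ^+ _).
have -> : #|A :&: B| =
    #|[set p : 'I_m * 'I_m | [&& p.1 \in A, p.2 \in B & p.2 == p.1]]|.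
  rewrite -(card_imset (A :&: B) (f := fun k => (k, k))) => [|k l [] //].
  apply: eq_card => -[a b]; apply/imsetP/idP => [[k]|].
    by rewrite !inE => /andP[kA kB] [-> ->]; rewrite kA kB eqxx.
  by rewrite inE/= => /and3P[aA bB /eqP ba]; exists a; rewrite ?inE ?ba ?aA -?ba.
rewrite -!sum1_card [X in (X + _)%N]big_mkcond [X in (_ + X)%N]big_mkcond.
rewrite -big_split/=; apply: eq_bigr => -[a b] _ /=.
rewrite !inE/= -val_eqE/= [in RHS]leq_eqVlt.
by case: (a \in A); case: (b \in B); case: ltngtP.
Qed.

(* This product form shows that [clsign] is bimultiplicative for the symmetric
   difference, which is the cocycle identity behind associativity. *)
Lemma clsign_symdl (A B C : {set 'I_m}) :
  clsign R (symd A B) C = clsign R A C * clsign R B C.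
Proof.
rewrite !clsignE -big_split/=; apply: eq_bigr => -[a b] _ /=.
rewrite in_symd -signr_addb; congr (_ ^+ nat_of_bool _).
by case: (a \in A); case: (a \in B); case: (b \in C); case: (_ <= _)%N.
Qed.

Lemma clsign_symdr (A B C : {set 'I_m}) :
  clsign R A (symd B C) = clsign R A B * clsign R A C.
Proof.
rewrite !clsignE -big_split/=; apply: eq_bigr => -[a b] _ /=.
rewrite in_symd -signr_addb; congr (_ ^+ nat_of_bool _).
by case: (a \in A); case: (b \in B); case: (b \in C); case: (_ <= _)%N.
Qed.

Lemma clsign0s (A : {set 'I_m}) : clsign R finset.set0 A = 1.
Proof. by rewrite clsignE big1// => p _; rewrite inE. Qed.

Lemma clsigns0 (A : {set 'I_m}) : clsign R A finset.set0 = 1.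
Proof. by rewrite clsignE big1// => p _; rewrite inE andbF. Qed.

Lemma clmulDl (x x' y : Cl) : (x + x') ** y = x ** y + x' ** y.
Proof.
rewrite /clmul -big_split/=; apply: eq_bigr => A _.
rewrite -big_split/=; apply: eq_bigr => B _.
by rewrite -scalerDl ffunE !mulrDl.
Qed.

Lemma clmulDr (x y y' : Cl) : x ** (y + y') = x ** y + x ** y'.
Proof.
rewrite /clmul -big_split/=; apply: eq_bigr => A _.
rewrite -big_split/=; apply: eq_bigr => B _.
by rewrite -scalerDl ffunE mulrDr mulrDl.
Qed.

Lemma clmulZl (c : R) (x y : Cl) : (c *: x) ** y = c *: (x ** y).
Proof.
rewrite /clmul scaler_sumr; apply: eq_bigr => A _.
rewrite scaler_sumr; apply: eq_bigr => B _.
by rewrite scalerA ffunE !mulrA.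
Qed.

Lemma clmulZr (c : R) (x y : Cl) : x ** (c *: y) = c *: (x ** y).
Proof.
rewrite /clmul scaler_sumr; apply: eq_bigr => A _.
rewrite scaler_sumr; apply: eq_bigr => B _.
by rewrite scalerA ffunE !mulrA [c * _]mulrC.
Qed.

Lemma clmul0l (y : Cl) : 0 ** y = 0.
Proof. by rewrite -[X in X ** _](scale0r (0 : Cl)) clmulZl scale0r. Qed.

Lemma clmul0r (x : Cl) : x ** 0 = 0.
Proof. by rewrite -[X in _ ** X](scale0r (0 : Cl)) clmulZr scale0r. Qed.

Lemma clmul_suml I (r : seq I) (P : pred I) (F : I -> Cl) y :
  (\sum_(k <- r | P k) F k) ** y = \sum_(k <- r | P k) (F k ** y).
Proof.
apply: (big_rec2 (fun a b => a ** y = b)) => [|k a b _ <-]; first exact: clmul0l.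
exact: clmulDl.
Qed.

Lemma clmul_sumr I (r : seq I) (P : pred I) (F : I -> Cl) x :
  x ** (\sum_(k <- r | P k) F k) = \sum_(k <- r | P k) (x ** F k).
Proof.
apply: (big_rec2 (fun a b => x ** a = b)) => [|k a b _ <-]; first exact: clmul0r.
exact: clmulDr.
Qed.

Lemma clbasis_sum (x : Cl) : x = \sum_A x A *: clbasis R A.
Proof.
apply/ffunP => B; rewrite sum_ffunE (bigD1 B)//= !ffunE eqxx [_ *: _]mulr1.
by rewrite big1 ?addr0// => A AB; rewrite !ffunE eq_sym (negbTE AB) [_ *: _]mulr0.
Qed.

Lemma clmul_basis (A B : {set 'I_m}) :
  clbasis R A ** clbasis R B = clsign R A B *: clbasis R (symd A B).
Proof.
rewrite /clmul (bigD1 A)//= (bigD1 B)//= !ffunE !eqxx !mul1r.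
rewrite !big1 ?addr0 ?mul1r ?scale1r// => [A' A'A|B' B'B].
  by rewrite big1// => B' _; rewrite !ffunE (negbTE A'A) mulr0n !mul0r scale0r.
by rewrite !ffunE (negbTE B'B) mulr0n mulr0 mul0r scale0r.
Qed.

(** Reduces multilinear identities to blades; associativity follows by using it once per
    argument. *)
Lemma cl_eq_linear (f g : Cl -> Cl) :
  {morph f : x y / x + y} -> (forall c, {morph f : x / c *: x}) ->
  {morph g : x y / x + y} -> (forall c, {morph g : x / c *: x}) ->
  (forall A, f (clbasis R A) = g (clbasis R A)) -> f =1 g.
Proof.
move=> fD fZ gD gZ fg x.
have f0 : f 0 = 0 by have := fZ 0 0; rewrite !scale0r.
have g0 : g 0 = 0 by have := gZ 0 0; rewrite !scale0r.
rewrite (clbasis_sum x) (big_morph f fD f0) (big_morph g gD g0).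
by apply: eq_bigr => A _; rewrite fZ gZ fg.
Qed.

Lemma clmulA (x y z : Cl) : x ** (y ** z) = (x ** y) ** z.
Proof.
apply: (cl_eq_linear (f := fun x => x ** (y ** z))
  (g := fun x => (x ** y) ** z)) => [a b|c a|a b|c a|A];
  rewrite ?clmulDl ?clmulZl ?clmulDl ?clmulZl//.
apply: (cl_eq_linear (f := fun y => clbasis R A ** (y ** z))
  (g := fun y => (clbasis R A ** y) ** z)) => [a b|c a|a b|c a|B];
  rewrite ?clmulDl ?clmulZl ?clmulDr ?clmulZr ?clmulDl ?clmulZl//.
apply: (cl_eq_linear (f := fun z => clbasis R A ** (clbasis R B ** z))
  (g := fun z => (clbasis R A ** clbasis R B) ** z)) => [a b|c a|a b|c a|C];
  rewrite ?clmulDr ?clmulZr ?clmulDr ?clmulZr//.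
rewrite 2!clmul_basis clmulZl clmulZr 2!clmul_basis 2!scalerA symdA.
by rewrite clsign_symdl clsign_symdr mulrCA [clsign R B C * _]mulrC.
Qed.

Lemma clmul1l (x : Cl) : clone R m ** x = x.
Proof.
apply: (cl_eq_linear (f := clmul (clone R m)) (g := id)) => // [a b|c a|A];
  rewrite ?clmulDr ?clmulZr//.
by rewrite clmul_basis clsign0s sym0d scale1r.
Qed.

Lemma clmul1r (x : Cl) : x ** clone R m = x.
Proof.
apply: (cl_eq_linear (f := fun x => x ** clone R m) (g := id)) => // [a b|c a|A] /=;
  rewrite ?clmulDl ?clmulZl//.
by rewrite clmul_basis clsigns0 symd0 scale1r.
Qed.

End CliffordAlgebra.

(** * Expansion of the exponential products *)

Section Distributivity.
Variables (R : realType) (V : lmodType R) (I : finType).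
Variables (op : I -> bool -> V -> V) (c : I -> bool -> R).
Hypothesis opD : forall p b, {morph op p b : v w / v + w}.
Hypothesis opZ : forall p b a, {morph op p b : v / a *: v}.

(** Bits outside [s] carry no choice; fixing them to [false] makes every choice along [s] count
    exactly once. *)
Definition supported (s : seq I) (J : {ffun I -> bool}) :=
  [forall q, (q \notin s) ==> ~~ J q].

Lemma supportedP s (J : {ffun I -> bool}) :
  reflect (forall q, q \notin s -> J q = false) (supported s J).
Proof.
apply: (iffP forallP) => [H q|H q]; first by move/implyP: (H q) => /[apply] /negbTE.
by apply/implyP => /H ->.
Qed.

(** The operators need not commute, so [foldr] keeps their order; [uniq s] makes the choices at the
    positions independent. *)
Lemma foldr_distr (s : seq I) (v : V) : uniq s ->
  foldr (fun p w => \sum_(b : bool) c p b *: op p b w) v s =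
  \sum_(J | supported s J)
     (\prod_(p <- s) c p (J p)) *: foldr (fun p => op p (J p)) v s.
Proof.
have op0 p b : op p b 0 = 0 by have := opZ p b 0 0; rewrite !scale0r.
elim: s => [_|p s ih /= /andP[ps us]] /=.
  rewrite (big_pred1 [ffun=> false]) ?big_nil ?scale1r// => J.
  apply/supportedP/eqP => [H|-> q]; last by rewrite ffunE.
  by apply/ffunP => q; rewrite ffunE H.
pose upd (J : {ffun I -> bool}) b := [ffun q => if q == p then b else J q].
have updE J b q : q \in s -> upd J b q = J q.
  by rewrite ffunE; case: eqP => // ->; rewrite (negbTE ps).
(* Arrays are sorted by their bit at the head [p]; setting and clearing that bit matches each class
   with the arrays supported on the tail. *)
rewrite (partition_big (fun J : {ffun I -> bool} => J p) predT)//=.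
apply: eq_bigr => b _; rewrite ih// (big_morph _ (opD p b) (op0 p b)) scaler_sumr.
rewrite [RHS](reindex_onto (fun J => upd J b) (fun J => upd J false)); last first.
  move=> J /andP[_ /eqP Jpb]; apply/ffunP => q; rewrite !ffunE.
  by case: eqP => [->|].
apply: eq_big => [J|J /supportedP HJ].
  apply/supportedP/andP => [H|[/andP[/supportedP H _] /eqP <-] q qs].
    split; last by apply/eqP/ffunP => q; rewrite !ffunE; case: eqP => // ->; rewrite H.
    rewrite ffunE !eqxx andbT; apply/supportedP => q.
    by rewrite in_cons negb_or ffunE => /andP[/negbTE -> /H].
  rewrite ffunE; case: eqP => // /eqP qp; apply: H.
  by rewrite in_cons (negbTE qp).
rewrite opZ scalerA big_cons [upd J b p]ffunE eqxx; congr (_ * _ *: op _ _ _).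
  by apply: eq_big_seq => q qs; rewrite updE.
elim: s updE {ps us ih HJ} => //= q s ih H; rewrite H ?mem_head// ih// => K b' r rs.
by rewrite H// in_cons rs orbT.
Qed.

End Distributivity.

(** * Expansion of the nested exponentials into words of sines and cosines *)

Section Expansion.
Variables (R : realType) (m mu : nat) (i : 'I_m -> {ffun {set 'I_m} -> R}).
Local Notation Cl := {ffun {set 'I_m} -> R}.
Local Notation "x ** y" := (clmul x y) (at level 40, left associativity).

Definition sandwich (a v b : Cl) : Cl := (a ** v) ** b.

Lemma sandwich_comp a a' v b b' :
  sandwich a (sandwich a' v b') b = sandwich (a ** a') v (b' ** b).
Proof. by rewrite /sandwich !clmulA. Qed.

Definition trig (b : bool) (t : R) : R := if b then sin t else cos t.

Definition trigprod (J : {ffun 'I_4 * 'I_m -> bool}) (x y z u : 'rV[R]_m) : R :=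
  \prod_(k < m) (trig (jent J 1 k) (x 0 k * u 0 k) *
                 trig (jent J 2 k) (y 0 k * u 0 k) *
                 trig (jent J 3 k) (z 0 k * u 0 k)).

(* Every exponential acts as one operator on the innermost factor, by left or
   right multiplication according to the side of [mu]; [order3] lists these
   operators from the outermost to the innermost. *)
Let side (p : 'I_4 * 'I_m) (e v : Cl) : Cl := if (p.2 < mu)%N then e ** v else v ** e.

Let unitv (p : 'I_4 * 'I_m) : Cl := if p.1 == inord 0 then i p.2 else - i p.2.

(** The head of a [foldr] list acts last, and among right factors the last one is outermost, hence
    [rev s2]. Left and right multiplications commute, so their relative order is immaterial. *)
Let ordering (nu : 'I_4) (s1 s2 : seq 'I_m) : seq ('I_4 * 'I_m) :=
  [seq (nu, k) | k <- s1] ++ [seq (nu, k) | k <- rev s2].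

Let foldr_ordering (a : 'I_4 * 'I_m -> Cl) nu s1 s2 v :
  all (fun k : 'I_m => k < mu)%N s1 -> all (fun k : 'I_m => mu <= k)%N s2 ->
  foldr (fun p => side p (a p)) v (ordering nu s1 s2) =
  sandwich (clprod [seq a (nu, k) | k <- s1]) v (clprod [seq a (nu, k) | k <- s2]).
Proof.
move=> h1 h2; rewrite /ordering foldr_cat.
have -> : foldr (fun p => side p (a p)) v [seq (nu, k) | k <- rev s2] =
    v ** clprod [seq a (nu, k) | k <- s2].
  elim: s2 h2 v => [_ v|k s2 ih /= /andP[mk /ih{}ih] v] /=.
    by rewrite clmul1r.
  by rewrite rev_cons map_rcons foldr_rcons ih /side/= ltnNge mk/= clmulA.
rewrite /sandwich -clmulA; elim: s1 h1 => [_|k s1 ih /= /andP[km /ih{}ih]] /=.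
  by rewrite clmul1l.
by rewrite ih /side/= km clmulA.
Qed.

Let idxF1_lt : all (fun k : 'I_m => k < mu)%N (idxF1 m mu).
Proof. exact: filter_all. Qed.

Let idxF2_ge : all (fun k : 'I_m => mu <= k)%N (idxF2 m mu).
Proof. exact: filter_all. Qed.

Let order3 : seq ('I_4 * 'I_m) :=
  ordering (inord 0) (rev (idxF1 m mu)) (rev (idxF2 m mu)) ++
  ordering (inord 1) (idxF1 m mu) (idxF2 m mu) ++
  ordering (inord 2) (idxF1 m mu) (idxF2 m mu).

Let foldr_order3 a v : foldr (fun p => side p (a p)) v order3 =
  sandwich (clprod [seq a (inord 0, k) | k <- rev (idxF1 m mu)])
   (sandwich (clprod [seq a (inord 1, k) | k <- idxF1 m mu])
    (sandwich (clprod [seq a (inord 2, k) | k <- idxF1 m mu]) v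
    (clprod [seq a (inord 2, k) | k <- idxF2 m mu]))
   (clprod [seq a (inord 1, k) | k <- idxF2 m mu]))
  (clprod [seq a (inord 0, k) | k <- rev (idxF2 m mu)]).
Proof. by rewrite /order3 2!foldr_cat !(foldr_ordering a)// all_rev. Qed.

Let perm_ordering nu s1 s2 : perm_eq s1 (idxF1 m mu) -> perm_eq s2 (idxF2 m mu) ->
  perm_eq (ordering nu s1 s2) [seq (nu, k) | k <- enum 'I_m].
Proof.
move=> h1 h2; rewrite /ordering -map_cat; apply: perm_map.
apply: (@perm_trans _ (idxF1 m mu ++ idxF2 m mu)).
  by apply: perm_cat => //; rewrite perm_rev.
rewrite /idxF1 /idxF2 (eq_filter (a1 := fun k : 'I_m => (mu <= k)%N)
  (a2 := predC (fun k : 'I_m => (k < mu)%N))); last by move=> k; rewrite /= -leqNgt.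
by rewrite perm_filterC.
Qed.

Let order3_uniq : uniq order3.
Proof.
have ou nu s1 s2 : perm_eq s1 (idxF1 m mu) -> perm_eq s2 (idxF2 m mu) ->
    uniq (ordering nu s1 s2).
  move=> h1 h2; rewrite (perm_uniq (perm_ordering nu h1 h2)).
  by rewrite map_inj_uniq ?enum_uniq// => k l [].
have on nu s1 s2 p : p \in ordering nu s1 s2 -> p.1 = nu.
  by rewrite mem_cat => /orP[] /mapP[k _ ->].
have i01 : inord 0 != inord 1 :> 'I_4 by rewrite -val_eqE/= !inordK.
have i02 : inord 0 != inord 2 :> 'I_4 by rewrite -val_eqE/= !inordK.
have i12 : inord 1 != inord 2 :> 'I_4 by rewrite -val_eqE/= !inordK.
have key n0 n1 n2 (s0 s1 s2 : seq ('I_4 * 'I_m)) : n0 != n1 -> n0 != n2 -> n1 != n2 ->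
    uniq s0 -> uniq s1 -> uniq s2 ->
    (forall p, p \in s0 -> p.1 = n0) -> (forall p, p \in s1 -> p.1 = n1) ->
    (forall p, p \in s2 -> p.1 = n2) -> uniq (s0 ++ s1 ++ s2).
  move=> n01 n02 n12 u0 u1 u2 h0 h1 h2; rewrite !cat_uniq u0 u1 u2/= andbT.
  apply/andP; split; apply/hasPn => p.
    by rewrite mem_cat => /orP[/h1|/h2] pn; apply/negP => /h0; apply/eqP; rewrite pn eq_sym.
  by move=> /h2 pn; apply/negP => /h1; apply/eqP; rewrite pn eq_sym.
by apply: (key _ _ _ _ _ _ i01 i02 i12); try exact: on; rewrite ou ?perm_rev.
Qed.

(** The fourth row is never listed, so being supported on [order3] amounts to [j_{4,k} = 0] for all
    [k]. *)
Let mem_order3 p : (p \in order3) = (p.1 != inord 3).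
Proof.
have mo nu s1 s2 : perm_eq s1 (idxF1 m mu) -> perm_eq s2 (idxF2 m mu) ->
    (p \in ordering nu s1 s2) = (p.1 == nu).
  move=> h1 h2; rewrite (perm_mem (perm_ordering nu h1 h2)).
  case: p => nu' k; apply/mapP/eqP => /= [[l _ []]//|->].
  by exists k => //; rewrite mem_enum.
rewrite /order3 mem_cat [X in _ || X]mem_cat !mo ?perm_rev// -!val_eqE/= !inordK//.
by case: p {mo} => -[[|[|[|[|//]]]]].
Qed.

Let prod_order3 (F : 'I_4 * 'I_m -> R) : \prod_(p <- order3) F p =
  \prod_(k < m) (F (inord 0, k) * F (inord 1, k) * F (inord 2, k)).
Proof.
have po nu s1 s2 : perm_eq s1 (idxF1 m mu) -> perm_eq s2 (idxF2 m mu) ->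
    \prod_(p <- ordering nu s1 s2) F p = \prod_(k < m) F (nu, k).
  move=> h1 h2; rewrite (perm_big _ (perm_ordering nu h1 h2))/=.
  by rewrite big_map big_enum.
by rewrite /order3 big_cat/= [X in _ * X]big_cat/= !po ?perm_rev// mulrA -!big_split.
Qed.

(** Each exponential acts linearly as a sum of two operators, so [foldr_distr] applies along
    [order3]; the scalars collect in [trigprod], the vectors in [lfactor] and [rfactor]. *)
Lemma sandwich_expprod (x y z u : 'rV[R]_m) (v : Cl) :
  sandwich (expprod i (rev (idxF1 m mu)) 1 x u)
   (sandwich (expprod i (idxF1 m mu) (-1) y u)
    (sandwich (expprod i (idxF1 m mu) (-1) z u) v (expprod i (idxF2 m mu) (-1) z u))
   (expprod i (idxF2 m mu) (-1) y u))
  (expprod i (rev (idxF2 m mu)) 1 x u) =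
  \sum_(J | [forall k, ~~ jent J 4 k])
    trigprod J x y z u *: sandwich (lfactor i mu J) v (rfactor i mu J).
Proof.
pose angle (p : 'I_4 * 'I_m) := (if p.1 == inord 0 then x else
  if p.1 == inord 1 then y else z) 0 p.2 * u 0 p.2.
pose a p := clexp (unitv p) (angle p).
have aE p : a p = \sum_(b : bool) trig b (angle p) *: clpow (unitv p) b.
  by rewrite big_bool/= addrC.
have i01 : (inord 1 == inord 0 :> 'I_4) = false by rewrite -val_eqE/= !inordK.
have i02 : (inord 2 == inord 0 :> 'I_4) = false by rewrite -val_eqE/= !inordK.
have i12 : (inord 2 == inord 1 :> 'I_4) = false by rewrite -val_eqE/= !inordK.
have a0 s : expprod i s 1 x u = clprod [seq a (inord 0, k) | k <- s].
  congr clprod; apply: eq_map => k.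
  by rewrite /a /unitv /angle/= eqxx mul1r.
(* The sign of an exponent moves into the vector: this is the origin of [- i k] in [lfactor] and
   [rfactor], and it leaves [trigprod] free of signs. *)
have clexpN v' t : clexp v' (-1 * t) = clexp (- v') t :> Cl.
  by rewrite /clexp mulN1r cosN sinN scaleNr scalerN.
have a1 s : expprod i s (-1) y u = clprod [seq a (inord 1, k) | k <- s].
  congr clprod; apply: eq_map => k.
  by rewrite /a /unitv /angle/= i01 eqxx clexpN.
have a2 s : expprod i s (-1) z u = clprod [seq a (inord 2, k) | k <- s].
  congr clprod; apply: eq_map => k.
  by rewrite /a /unitv /angle/= i02 i12 clexpN.
rewrite !a0 !a1 !a2 -foldr_order3.
have -> : foldr (fun p => side p (a p)) v order3 =
   foldr (fun p w => \sum_(b : bool) trig b (angle p) *: side p (clpow (unitv p) b) w)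
     v order3.
  elim: order3 => //= p s ->; rewrite aE /side; case: ifP => _.
    by rewrite clmul_suml; apply: eq_bigr => b _; rewrite clmulZl.
  by rewrite clmul_sumr; apply: eq_bigr => b _; rewrite clmulZr.
rewrite (foldr_distr (op := fun p b w => side p (clpow (unitv p) b) w)
  (fun p b => trig b (angle p)))//; last 2 first.
- by move=> p b v' w; rewrite /side; case: ifP => _; rewrite (clmulDl, clmulDr).
- by move=> p b c v'; rewrite /side; case: ifP => _; rewrite (clmulZl, clmulZr).
apply: eq_big => [J|J _].
  apply/supportedP/forallP => [H k|H [nu k]].
    by rewrite /jent H// mem_order3/= eqxx.
  by rewrite mem_order3/= negbK => /eqP ->; apply/negbTE/H.
congr (_ *: _).
  rewrite prod_order3; apply: eq_bigr => k _.
  by rewrite /angle/= i01 i02 i12 !eqxx.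
rewrite (foldr_order3 (fun p => clpow (unitv p) (J p))) !sandwich_comp.
by rewrite /unitv/= eqxx i01 i02 /lfactor /rfactor !clmulA.
Qed.

End Expansion.

(** * Gaussian integrals *)

Section RealIntegrals.
Local Open Scope classical_set_scope.
Context d (T : measurableType d) (R : realType).
Variable mu : {measure set T -> \bar R}.
Local Notation rint f := (Rintegral mu setT f).
Local Notation rintegrable f := (mu.-integrable setT (EFin \o f)).

Lemma rintegrable_measurable (f : T -> R) :
  rintegrable f -> measurable_fun setT f.
Proof. by move=> /measurable_int/measurable_EFinP. Qed.

Lemma le_rintegrable (f g : T -> R) : measurable_fun setT f ->
  (forall x, `|f x| <= g x) -> rintegrable g -> rintegrable f.
Proof.
move=> mf fg; apply: le_integrable => //; first exact/measurable_EFinP.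
by move=> x _; rewrite /= lee_fin (le_trans (fg x)) ?ler_norm.
Qed.

Lemma rintegrableZ (c : R) (f : T -> R) :
  rintegrable f -> rintegrable (fun x => c * f x).
Proof. by move=> fi; exact: (integrableZl measurableT c fi). Qed.

Lemma rintegrableD (f g : T -> R) :
  rintegrable f -> rintegrable g -> rintegrable (fun x => f x + g x).
Proof. by move=> fi gi; exact: (integrableD measurableT fi gi). Qed.

Lemma rintegrable_sum I (r : seq I) (P : pred I) (F : I -> T -> R) :
  (forall k, P k -> rintegrable (F k)) ->
  rintegrable (fun x => \sum_(k <- r | P k) F k x).
Proof.
move=> Fi; have := integrable_sum measurableT r (h := fun k => EFin \o F k) Fi.
apply: eq_integrable => // x _ /=.
by rewrite sumEFin.
Qed.

Lemma rintegrable_norm (f : T -> R) :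
  rintegrable f -> rintegrable (fun x => `|f x|).
Proof. exact: integrable_norm. Qed.

Lemma rintZ (c : R) (f : T -> R) : rintegrable f ->
  rint (fun x => c * f x) = c * rint f.
Proof. exact: RintegralZl. Qed.

Lemma rint_sum I (r : seq I) (P : pred I) (F : I -> T -> R) :
  (forall k, P k -> rintegrable (F k)) ->
  rint (fun x => \sum_(k <- r | P k) F k x) = \sum_(k <- r | P k) rint (F k).
Proof.
move=> Fi; elim: r => [|k r ih].
  under eq_Rintegral do rewrite big_nil; rewrite big_nil.
  by rewrite /Rintegral integral0.
under eq_Rintegral do rewrite big_cons; rewrite big_cons.
case: ifPn => Pk //; rewrite RintegralD ?ih//; first exact: Fi.
exact: rintegrable_sum.
Qed.

Lemma rint_dominated_cvg (f_ : nat -> T -> R) (f g : T -> R) :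
  (forall n, measurable_fun setT (f_ n)) -> (forall x, f_ ^~ x @ \oo --> f x) ->
  rintegrable g -> (forall n x, `|f_ n x| <= g x) ->
  rint (f_ n) @[n --> \oo] --> rint f.
Proof.
move=> mf f_f gi fg.
have mlim : measurable_fun setT (EFin \o f).
  apply/measurable_EFinP; exact: (measurable_fun_cvg (h := f_)).
have mf' n : measurable_fun setT (EFin \o f_ n) by exact/measurable_EFinP.
have cf : {ae mu, forall x, setT x -> EFin \o (f_ ^~ x) @ \oo --> (EFin \o f) x}.
  by apply: aeW => x _; apply: cvg_EFin; [exact: nearW|exact: f_f].
have bf : {ae mu, forall x n, setT x -> (`|(EFin \o f_ n) x| <= (EFin \o g) x)%E}.
  by apply: aeW => x n _; rewrite /= lee_fin.
have [_ _ H] := dominated_convergence measurableT mf' mlim cf gi bf.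
apply: fine_cvg; rewrite fineK; first exact: H.
apply: integrable_fin_num => //; apply: (le_rintegrable _ _ gi).
  exact/measurable_EFinP.
move=> x; have fx : `|f_ n x| @[n --> \oo] --> `|f x| by exact: cvg_norm (f_f x).
rewrite -(cvg_lim (@Rhausdorff R) fx); apply: limr_le; last exact: nearW.
by apply/cvg_ex; exists `|f x|.
Qed.

End RealIntegrals.

(** * Gaussian integrals and the cosine transform of a Gaussian *)

Section Gaussian.
Local Open Scope classical_set_scope.
Variable R : realType.
Local Notation leb := (@lebesgue_measure R).
Local Notation rint f := (Rintegral leb setT f).
Local Notation rintegrable f := (leb.-integrable setT (EFin \o f)).

(** The fundamental theorem of calculus on growing symmetric intervals; integrability of [g] lets
    dominated convergence pass to the whole line. *)
Lemma rint_derivative_eq0 (G g : R -> R) :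
  continuous g -> rintegrable g -> (forall x : R, is_derive x (1 : R) G (g x)) ->
  G n.+1%:R @[n --> \oo] --> (0 : R) -> G (- n.+1%:R) @[n --> \oo] --> (0 : R) ->
  rint g = 0.
Proof.
move=> cg gi dG Gy GNy.
have mg := rintegrable_measurable gi.
(* The radius [n.+1] keeps the interval nondegenerate at [n = 0]. *)
pose D (n : nat) : set R := `[- n.+1%:R, n.+1%:R]%classic.
have mD n : measurable (D n) by exact: measurable_itv.
have cvg1 : rint (g \_ (D n)) @[n --> \oo] --> rint g.
  apply: (rint_dominated_cvg _ _ (rintegrable_norm gi)).
  - by move=> n; apply: (proj1 (measurable_restrictT g (mD n))); exact: measurable_funTS.
  - move=> x; apply: cvg_near_cst; near=> n.
    rewrite patchE ifT// inE /D/= in_itv/= -ler_norml.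
    near: n; exists (Num.truncn `|x|) => // n /= xn.
    by rewrite (le_trans (ltW (truncnS_gt _)))// ler_nat ltnS.
  - move=> n x; rewrite patchE; case: ifP => // _.
    by rewrite normr0.
have E n : rint (g \_ (D n)) = G n.+1%:R - G (- n.+1%:R).
  rewrite -Rintegral_mkcond /Rintegral (@continuous_FTC2 _ g G)//.
  - by rewrite -subr_gt0 opprK addr_gt0.
  - exact: continuous_subspaceT.
  - split => [x _||]; first by have [] := dG x.
    + apply: cvg_at_right_filter; apply: differentiable_continuous.
      by apply/derivable1_diffP; have [] := dG (- n.+1%:R).
    + apply: cvg_at_left_filter; apply: differentiable_continuous.
      by apply/derivable1_diffP; have [] := dG n.+1%:R.
  - by move=> x _; rewrite derive1E; apply: derive_val.
have cvg2 : rint (g \_ (D n)) @[n --> \oo] --> (0 : R).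
  under eq_fun do rewrite E.
  suff : G n.+1%:R - G (- n.+1%:R) @[n --> \oo] --> (0 : R) - 0 by rewrite subr0.
  exact: cvgB.
exact: (cvg_unique _ cvg1 cvg2).
Unshelve. all: by end_near.
Qed.

Definition gauss (a u : R) : R := expR (- (a * u ^+ 2)).

Lemma gauss_ge0 a u : 0 <= gauss a u. Proof. exact: expR_ge0. Qed.

Lemma is_derive_gauss a (u : R) :
  is_derive u (1 : R) (gauss a) (- (2 * a * u) * gauss a u).
Proof.
have H : is_derive u (1 : R) (fun u => - (a * u ^+ 2)) (- (2 * a * u)).
  apply: is_derive_eq; rewrite /GRing.scale/=.
  ring.
apply: (is_derive_eq (is_derive1_comp (is_derive_expR _) H)).
by rewrite mulrC.
Qed.

Lemma continuous_gauss a : continuous (gauss a).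
Proof.
move=> u; apply: differentiable_continuous; apply/derivable1_diffP.
by have [] := is_derive_gauss a u.
Qed.

Lemma gauss_shift_integral (a b : R) : 0 < a ->
  rintegrable (fun u => gauss a (u - b)) /\
  rint (fun u => gauss a (u - b)) = Num.sqrt (pi / a).
Proof.
(* [s ^+ 2] is the variance for which the normal density centred at [b] is proportional to
   [gauss a (u - b)]. *)
move=> a0; pose s : R := Num.sqrt (2 * a)^-1.
have s2 : s ^+ 2 = (2 * a)^-1 by rewrite sqr_sqrtr// invr_ge0 mulr_ge0// ltW.
have s0 : s != 0 by rewrite gt_eqF// sqrtr_gt0 invr_gt0 mulr_gt0.
have E : normal_pdf b s = fun u => normal_peak s * gauss a (u - b).
  rewrite normal_pdfE//; apply/funext => u; rewrite /gauss /normal_fun.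
  congr (_ * expR _); rewrite s2; field.
  by rewrite gt_eqF.
have Ei := integrable_normal_pdf b s.
have peak0 : normal_peak s != 0 by rewrite gt_eqF// normal_peak_gt0.
have gE : (fun u => gauss a (u - b)) = fun u => (normal_peak s)^-1 * normal_pdf b s u.
  by apply/funext => u; rewrite E mulKf.
rewrite gE; split; first exact: (rintegrableZ _ Ei).
rewrite (rintZ _ Ei) /Rintegral integral_normal_pdf/= mulr1 /normal_peak invrK.
congr Num.sqrt; rewrite s2; field.
by rewrite gt_eqF.
Qed.

Lemma gauss_integral (a : R) : 0 < a ->
  rintegrable (gauss a) /\ rint (gauss a) = Num.sqrt (pi / a).
Proof.
move=> /(gauss_shift_integral 0) H.
by have <- : (fun u => gauss a (u - 0)) = gauss a by apply/funext => u; rewrite subr0.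
Qed.

(** Half of the exponent absorbs the factor [|u|]. This function later dominates the derivative in
    [w] of the cosine integrand. *)
Lemma gauss_first_moment (a : R) : 0 < a -> rintegrable (fun u => `|u| * gauss a u).
Proof.
move=> a0; have [gi _] := @gauss_integral (a / 2) (divr_gt0 a0 (ltr0Sn _ _)).
(* The constant comes from [|u| <= 1 + u ^+ 2 <= (1 + 2 / a) * (1 + a / 2 * u ^+ 2)], whose last
   factor is at most [expR (a / 2 * u ^+ 2)]. *)
apply: le_rintegrable (rintegrableZ (1 + 2 / a) gi).
  apply: continuous_measurable_fun => u; apply: cvgM; first exact: norm_continuous.
  exact: continuous_gauss.
move=> u; rewrite normrM normr_id (ger0_norm (gauss_ge0 _ _)).
have -> : gauss a u = (expR (a / 2 * u ^+ 2))^-1 * gauss (a / 2) u.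
  rewrite /gauss -expRN -expRD; congr expR; by field.
rewrite mulrA ler_wpM2r ?gauss_ge0// ler_pdivrMr ?expR_gt0//.
apply: (@le_trans _ _ ((1 + 2 / a) * (1 + a / 2 * u ^+ 2))); last first.
  by rewrite ler_wpM2l ?expR_ge1Dx// addr_ge0// divr_ge0// ltW.
have -> : (1 + 2 / a) * (1 + a / 2 * u ^+ 2) = 1 + u ^+ 2 + a / 2 * u ^+ 2 + 2 / a.
  by field; rewrite gt_eqF.
have h1 : 0 <= a / 2 * u ^+ 2 by rewrite mulr_ge0 ?sqr_ge0// divr_ge0// ltW.
have h2 : 0 <= 2 / a by rewrite divr_ge0// ltW.
have h3 : `|u| <= 1 + u ^+ 2 by rewrite -(real_normK (num_real u)); nra.
lra.
Qed.

(* For fixed [t], the integral satisfies [F' w = - w / (2 a) * F w]. *)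
Section CosTransform.
Variables (a t : R).
Hypothesis a0 : 0 < a.

Let F w := rint (fun u => cos (w * u + t) * gauss a u).

Let continuous_affine (w : R) : continuous (fun u : R => w * u + t).
Proof. by move=> u; apply: cvgD; [apply: cvgM; [exact: cvg_cst|exact: cvg_id]|exact: cvg_cst]. Qed.

Let continuous_cosaffine (w : R) : continuous (fun u : R => cos (w * u + t)).
Proof. by move=> u; apply: continuous_comp; [exact: continuous_affine|exact: continuous_cos]. Qed.

Let continuous_sinaffine (w : R) : continuous (fun u : R => sin (w * u + t)).
Proof. by move=> u; apply: continuous_comp; [exact: continuous_affine|exact: continuous_sin]. Qed.

Let norm_cos_le1 (x : R) : `|cos x| <= 1.
Proof. by rewrite ler_norml cos_geN1 cos_le1. Qed.

Let norm_sin_le1 (x : R) : `|sin x| <= 1.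
Proof. by rewrite ler_norml sin_geN1 sin_le1. Qed.

Lemma rintegrable_cos_gauss w : rintegrable (fun u => cos (w * u + t) * gauss a u).
Proof.
apply: le_rintegrable (gauss_integral a0).1.
  apply: continuous_measurable_fun => u; apply: cvgM; last exact: continuous_gauss.
  exact: continuous_cosaffine.
move=> u; rewrite normrM (ger0_norm (gauss_ge0 _ _)).
by rewrite ler_piMl// gauss_ge0.
Qed.

Let cosgi := rintegrable_cos_gauss.

Let usingi w : rintegrable (fun u => - (u * sin (w * u + t)) * gauss a u).
Proof.
apply: le_rintegrable (gauss_first_moment a0).
  apply: continuous_measurable_fun => u; apply: cvgM; last exact: continuous_gauss.
  by apply: cvgN; apply: cvgM; [exact: cvg_id|exact: continuous_sinaffine].
move=> u; rewrite normrM normrN normrM (ger0_norm (gauss_ge0 _ _)).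
by rewrite ler_wpM2r ?gauss_ge0// ler_piMr.
Qed.

Let dcos u w : is_derive w (1 : R) (fun w => cos (w * u + t) * gauss a u)
   (- (u * sin (w * u + t)) * gauss a u).
Proof.
have H : is_derive w (1 : R) (fun w => w * u + t) u.
  by apply: is_derive_eq; rewrite /GRing.scale/= addr0 mulr0 add0r mulr1.
have H2 := is_derive1_comp (is_derive_cos _) H.
apply: is_derive_eq; rewrite /GRing.scale/=.
by rewrite mulr0 add0r; ring.
Qed.

(** Differentiation under the integral sign: the majorant [|u| * gauss a u] is independent of
    [w]. *)
Let dF w : is_derive w (1 : R) F (rint (fun u => - (u * sin (w * u + t)) * gauss a u)).
Proof.
have Iw : (`]w - 1, w + 1[%classic : set R) w.
  by rewrite /= in_itv/= ltrBlDr ltrDl ltr01.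
have d1 w' u : partial1of2 (fun w u => cos (w * u + t) * gauss a u) w' u =
    - (u * sin (w' * u + t)) * gauss a u.
  by rewrite partial1of2E; have [_ ->] := dcos u w'.
have derf1 (x y : R) : `]w - 1, w + 1[%classic x -> setT y ->
    derivable (fun w : R => cos (w * y + t) * gauss a y) x 1.
  by move=> _ _; have [] := dcos y x.
have G0 (u : R) : 0 <= `|u| * gauss a u by rewrite mulr_ge0 ?gauss_ge0.
have Gub (x y : R) : `]w - 1, w + 1[%classic x -> setT y ->
    `|partial1of2 (fun w u => cos (w * u + t) * gauss a u) x y| <= `|y| * gauss a y.
  move=> _ _; rewrite d1 normrM normrN normrM (ger0_norm (gauss_ge0 _ _)).
  by rewrite ler_wpM2r ?gauss_ge0// ler_piMr.
split.
  exact: (derivable_under_integral measurableT Iw (fun w _ => cosgi w) derf1 G0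
    (gauss_first_moment a0) Gub).
rewrite -derive1E (differentiation_under_integral measurableT Iw (fun w _ => cosgi w)
  derf1 G0 (gauss_first_moment a0) Gub).
by apply: eq_Rintegral => u _; exact: d1.
Qed.

Let gauss_le_inv (n : nat) : gauss a n.+1%:R <= a^-1 * n.+1%:R^-1.
Proof.
rewrite /gauss expRN -invfM lef_pV2 ?posrE ?expR_gt0 ?mulr_gt0//.
apply: le_trans (expR_ge1Dx _).
have h : 1 <= n.+1%:R :> R by rewrite ler1n.
have : a * n.+1%:R <= a * n.+1%:R ^+ 2.
  by rewrite ler_pM2l// expr2 ler_peMl// (le_trans ler01).
lra.
Qed.

(** Integration by parts: [g] is the derivative of [sin (w * u + t) * gauss a u], which vanishes at
    both infinities. *)
Let usin_eq w : rint (fun u => - (u * sin (w * u + t)) * gauss a u) =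
  - (w / (2 * a)) * F w.
Proof.
pose G u := sin (w * u + t) * gauss a u.
pose g u := w * (cos (w * u + t) * gauss a u) +
  2 * a * (- (u * sin (w * u + t)) * gauss a u).
have gi : rintegrable g by apply: rintegrableD; apply: rintegrableZ.
have dG (u : R) : is_derive u (1 : R) G (g u).
  have H : is_derive u (1 : R) (fun u => w * u + t) w.
    by apply: is_derive_eq; rewrite /GRing.scale/= addr0 mulr1.
  have H2 := is_derive1_comp (is_derive_sin _) H.
  have H3 := is_derive_gauss a u.
  apply: is_derive_eq; rewrite /GRing.scale/= /g; ring.
have Gle s u : `|G (s * u)| <= gauss a (s * u).
  by rewrite /G normrM (ger0_norm (gauss_ge0 _ _)) ler_piMl// gauss_ge0.
(* Here [s] is [1] or [- 1], which treats both ends of the line at once. *)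
have Gcvg s : s ^+ 2 = 1 -> G (s * n.+1%:R) @[n --> \oo] --> (0 : R).
  move=> s1; apply: norm_cvg0.
  apply: (@squeeze_cvgr _ _ _ _ (fun=> 0) (fun n => a^-1 * n.+1%:R^-1)).
  - apply: nearW => n; rewrite normr_ge0/= (le_trans (Gle _ _))//.
    by rewrite /gauss exprMn s1 mul1r gauss_le_inv.
  - exact: cvg_cst.
  - rewrite -(mulr0 a^-1); apply: cvgM; first exact: cvg_cst.
    exact: cvg_harmonic.
have : rint g = 0.
  apply: (@rint_derivative_eq0 G) => //.
  - move=> u; apply: cvgD; apply: cvgM; try exact: cvg_cst.
      by apply: cvgM; [exact: continuous_cosaffine|exact: continuous_gauss].
    apply: cvgM; last exact: continuous_gauss.
    by apply: cvgN; apply: cvgM; [exact: cvg_id|exact: continuous_sinaffine].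
  - by have := Gcvg 1 (expr1n _ _); under eq_fun do rewrite mul1r.
  - have := Gcvg (- 1) _; under eq_fun do rewrite mulN1r.
    by apply; rewrite sqrrN expr1n.
rewrite /g RintegralD//; [|exact: rintegrableZ..].
rewrite !rintZ// -/(F w) => H.
have a20 : 2 * a != 0 by rewrite mulf_neq0// gt_eqF.
apply: (mulfI a20); transitivity (- (w * F w)); first by lra.
by field; rewrite gt_eqF.
Qed.

Lemma gauss_cos_transform w : rint (fun u => cos (w * u + t) * gauss a u) =
  cos t * Num.sqrt (pi / a) * gauss (4 * a)^-1 w.
Proof.
rewrite /gauss expRN [_ * w ^+ 2]mulrC.
(* The exponential is an integrating factor for the differential equation of [F]: [H] is constant,
   and [H 0] is [cos t] times the Gaussian mass. *)
pose H w := F w * expR (w ^+ 2 / (4 * a)).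
have dH v : is_derive v (1 : R) H 0.
  have D := dF v; rewrite usin_eq in D.
  have D1 : is_derive v (1 : R) (fun v => v ^+ 2 / (4 * a)) (v / (2 * a)).
    apply: is_derive_eq; rewrite /GRing.scale/=.
    by field; rewrite gt_eqF.
  have D2 := is_derive1_comp (is_derive_expR _) D1.
  apply: is_derive_eq; rewrite /GRing.scale/=; ring.
have : H w = H 0 by exact: is_derive_0_is_cst.
rewrite /H expr0n/= mul0r expR0 mulr1 -/(F w) => E.
rewrite -[LHS](mulfK (_ : expR (w ^+ 2 / (4 * a)) != 0)) ?gt_eqF ?expR_gt0//.
rewrite E; congr (_ / _); rewrite /F.
under eq_Rintegral do rewrite mul0r add0r.
by have [gi gE] := gauss_integral a0; rewrite rintZ ?gE.
Qed.

End CosTransform.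

End Gaussian.

(** * One-dimensional integrals *)

Section OneDim.
Local Open Scope classical_set_scope.
Variable R : realType.
Local Notation leb := (@lebesgue_measure R).
Local Notation rint f := (Rintegral leb setT f).
Local Notation rintegrable f := (leb.-integrable setT (EFin \o f)).

(** A quarter-turn shift lets one cosine identity cover all eight products of sines and cosines. *)
Lemma trigE (b : bool) (t : R) : trig b t = cos (t - b%:R * (pi / 2)).
Proof.
case: b; last by rewrite mul0r subr0.
by rewrite mul1r cosB cos_pihalf sin_pihalf mulr0 add0r mulr1.
Qed.

Lemma norm_trig_le1 (b : bool) (t : R) : `|trig b t| <= 1.
Proof. by rewrite trigE ler_norml cos_geN1 cos_le1. Qed.

Lemma continuous_trig (b : bool) : continuous (@trig R b).
Proof. by case: b; [exact: continuous_sin|exact: continuous_cos]. Qed.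

(** The four product-to-sum terms are indexed so that [A] and [B] combine as the coordinates of [x]
    and [y] do in the reflected, translated argument of [f]. *)
Lemma mul_cos3 (A B C : R) : cos A * cos B * cos C =
  4^-1 * \sum_(phi : bool) \sum_(gam : bool)
    cos (C - (-1) ^+ gam * (A - (-1) ^+ phi * B)).
Proof.
rewrite !big_bool/= !expr1 !expr0 !mul1r !mulN1r !opprK.
rewrite !(cosB, cosD, sinB, sinD, cosN, sinN); by field.
Qed.

(* The one-coordinate factor of [ccoef] when [j_4 = 0]. *)
Definition trig_sign (b1 b2 b3 phi gam : bool) : R :=
  if [|| b1, b2 | b3] then
    (-1) ^+ ~~ (if phi then ~~ gam && b3 else if gam then b2 else b1)
  else 1.

(* [trig b t] is [cos] shifted by [b] quarter turns; the left-hand side is the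
   resulting phase in [mul_cos3]. *)
Lemma trig_signE (b1 b2 b3 phi gam : bool) :
  cos ((-1) ^+ gam * (b1%:R - (-1) ^+ phi * b2%:R) * (pi / 2) - b3%:R * (pi / 2)) =
  (~~ odd (b1 + b2 + b3))%:R * trig_sign b1 b2 b3 phi gam.
Proof.
have h : cos (pi / 2) = 0 :> R := cos_pihalf _.
have h' : sin (pi / 2) = 1 :> R := sin_pihalf _.
move: (pi / 2) h h' => q h h'.
case: b1 b2 b3 phi gam => [] [] [] [] []; rewrite /trig_sign/=.
all: rewrite ?mulr1n ?mulr0n ?expr0 ?expr1.
all: rewrite !(mulrBl, mulrBr, mulrDl, mulNr, mul1r, mulr1, mulr0, mul0r, subr0, sub0r).
all: rewrite ?(opprK, opprB).
all: rewrite ?(cosB, sinB, cosD, sinD, cosN, sinN, cos0, sin0) ?h ?h'.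
all: try by ring.
Qed.

Lemma rint_trig3 (b1 b2 b3 : bool) (x y z a : R) : 0 < a ->
  rint (fun u => trig b1 (x * u) * trig b2 (y * u) * trig b3 (z * u) * gauss a u) =
  (~~ odd (b1 + b2 + b3))%:R * (Num.sqrt (pi / a) / 4) *
  \sum_(phi : bool) \sum_(gam : bool) trig_sign b1 b2 b3 phi gam *
    gauss (4 * a)^-1 (z - (-1) ^+ gam * (x - (-1) ^+ phi * y)).
Proof.
move=> a0.
pose w (phi gam : bool) := z - (-1) ^+ gam * (x - (-1) ^+ phi * y).
(* The quarter turns combine like the frequencies: [t] is minus [w] with the bits in place of the
   coordinates, times [pi / 2]. *)
pose t (phi gam : bool) : R :=
  (-1) ^+ gam * (b1%:R - (-1) ^+ phi * b2%:R) * (pi / 2) - b3%:R * (pi / 2).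
have E u : trig b1 (x * u) * trig b2 (y * u) * trig b3 (z * u) * gauss a u =
  4^-1 * \sum_(phi : bool) \sum_(gam : bool) cos (w phi gam * u + t phi gam) * gauss a u.
  rewrite !trigE mul_cos3 -mulrA mulr_suml; congr (_ * _); apply: eq_bigr => phi _.
  rewrite mulr_suml; apply: eq_bigr => gam _; congr (cos _ * _).
  by rewrite /w /t; ring.
under eq_Rintegral do rewrite E.
have ci phi gam : rintegrable (fun u => cos (w phi gam * u + t phi gam) * gauss a u).
  exact: rintegrable_cos_gauss.
rewrite rintZ; last by apply: rintegrable_sum => phi _; exact: rintegrable_sum.
rewrite rint_sum; last by move=> phi _; exact: rintegrable_sum.
rewrite [_ / 4]mulrC mulrCA -!mulrA; congr (_ * _).
rewrite !mulr_sumr; apply: eq_bigr => phi _.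
rewrite rint_sum// !mulr_sumr; apply: eq_bigr => gam _.
rewrite gauss_cos_transform// trig_signE -/(w phi gam); ring.
Qed.

End OneDim.

(** * Product measures *)

Section Tensor.
Local Open Scope classical_set_scope.
Context d1 d2 (T1 : measurableType d1) (T2 : measurableType d2) (R : realType).
Variable m1 : {sigma_finite_measure set T1 -> \bar R}.
Variable m2 : {sigma_finite_measure set T2 -> \bar R}.

Lemma Rintegral_EFin d (T : measurableType d) (mu : {measure set T -> \bar R}) (f : T -> R) :
  mu.-integrable setT (EFin \o f) ->
  (\int[mu]_x (f x)%:E)%E = (Rintegral mu setT f)%:E.
Proof. by move=> fi; rewrite /Rintegral fineK// integrable_fin_num. Qed.

Lemma rintegrable_tensor (f : T1 -> R) (g : T2 -> R) :
  m1.-integrable setT (EFin \o f) -> m2.-integrable setT (EFin \o g) ->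
  (m1 \x m2)%E.-integrable setT (EFin \o (fun p => f p.1 * g p.2)).
Proof.
move=> fi gi; apply/integrable12ltyP.
  apply/measurable_EFinP; apply: measurable_funM.
    exact: (measurableT_comp (rintegrable_measurable fi) measurable_fst).
  exact: (measurableT_comp (rintegrable_measurable gi) measurable_snd).
have E x : (\int[m2]_y `|(EFin \o (fun p : T1 * T2 => f p.1 * g p.2)%R) (x, y)|)%E =
    (`|f x| * Rintegral m2 setT (fun y => `|g y|))%:E.
  rewrite -rintZ ?rintegrable_norm// -Rintegral_EFin.
    by apply: eq_integral => y _ /=; rewrite normrM.
  exact/rintegrableZ/rintegrable_norm.
under eq_integral do rewrite E.
rewrite Rintegral_EFin ?ltry//.
under [X in _.-integrable _ X]eq_fun do rewrite /= mulrC.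
exact/rintegrableZ/rintegrable_norm.
Qed.

Lemma rint_tensor (f : T1 -> R) (g : T2 -> R) :
  m1.-integrable setT (EFin \o f) -> m2.-integrable setT (EFin \o g) ->
  Rintegral (m1 \x m2)%E setT (fun p => f p.1 * g p.2) =
  Rintegral m1 setT f * Rintegral m2 setT g.
Proof.
move=> fi gi; have fgi := rintegrable_tensor fi gi.
rewrite {1}/Rintegral -(integral12_prod_meas1 fgi).
have E x : fubini_F m2 (EFin \o (fun p : T1 * T2 => f p.1 * g p.2)) x =
    (f x * Rintegral m2 setT g)%:E.
  by rewrite -rintZ// -Rintegral_EFin//; exact: rintegrableZ.
under eq_integral do rewrite E.
rewrite -[LHS]/(Rintegral m1 setT (fun x => f x * Rintegral m2 setT g)).
by under eq_Rintegral do rewrite mulrC; rewrite rintZ// mulrC.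
Qed.

(** The product bound yields joint integrability and also that of every slice, so all the inner
    real-valued integrals are finite. *)
Lemma rint_Fubini (F : T1 * T2 -> R) (f : T1 -> R) (g : T2 -> R) :
  measurable_fun setT F -> (forall x y, `|F (x, y)| <= f x * g y) ->
  m1.-integrable setT (EFin \o f) -> m2.-integrable setT (EFin \o g) ->
  Rintegral m1 setT (fun x => Rintegral m2 setT (fun y => F (x, y))) =
  Rintegral m2 setT (fun y => Rintegral m1 setT (fun x => F (x, y))).
Proof.
move=> mF Fle fi gi.
have Fi : (m1 \x m2)%E.-integrable setT (EFin \o F).
  by apply: (le_rintegrable mF _ (rintegrable_tensor fi gi)) => -[x y]; exact: Fle.
have i2 x : m2.-integrable setT (EFin \o (fun y => F (x, y))).
  by apply: (le_rintegrable _ (Fle x) (rintegrableZ _ gi)); exact: measurableT_comp.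
have i1 y : m1.-integrable setT (EFin \o (fun x => F (x, y))).
  apply: (@le_rintegrable _ _ _ _ _ (fun x => g y * f x)).
  - exact: measurableT_comp.
  - by move=> x; rewrite mulrC.
  - exact: rintegrableZ.
rewrite {1}/Rintegral; under eq_integral do rewrite -Rintegral_EFin//.
rewrite (Fubini Fi) /Rintegral; congr fine.
by apply: eq_integral => y _; rewrite Rintegral_EFin.
Qed.

End Tensor.

(** * Product functions on the iterated product space *)

Section Rn.
Local Open Scope classical_set_scope.
Variable R : realType.
Local Notation Om n := (ms_type (lebRn R n)).
Local Notation lam n := (ms_mu (lebRn R n)).

Lemma measurable_Rn_coord n k : measurable_fun setT (fun p : Om n => Rn_coord p k).
Proof.
elim: n k => [|n ih] k /=; first exact: measurable_cst.
case: k => [|k]; first exact: measurable_fst.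
exact: (measurableT_comp (ih k) measurable_snd).
Qed.

(** Induction peels off the first coordinate; in dimension [0] the unit Dirac mass matches the empty
    product. *)
Lemma rint_prod_coord n (g : 'I_n -> R -> R) :
  (forall k, (@lebesgue_measure R).-integrable setT (EFin \o g k)) ->
  (lam n).-integrable setT (EFin \o (fun p => \prod_(k < n) g k (Rn_coord p k))) /\
  Rintegral (lam n) setT (fun p => \prod_(k < n) g k (Rn_coord p k)) =
    \prod_(k < n) Rintegral (@lebesgue_measure R) setT (g k).
Proof.
elim: n g => [|n ih] g gi.
  split.
    under [X in _.-integrable _ (_ \o X)]eq_fun do rewrite big_ord0.
    exact: finite_measure_integrable_cst.
  under eq_Rintegral do rewrite big_ord0.
  by rewrite big_ord0 Rintegral_cst//= mul1r indicT.
have [ii ie] := ih (fun k => g (lift ord0 k)) (fun k => gi (lift ord0 k)).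
have E : (fun p : Om n.+1 => \prod_(k < n.+1) g k (Rn_coord p k)) =
    (fun p => g ord0 p.1 * (\prod_(k < n) g (lift ord0 k) (Rn_coord p.2 k))).
  by apply/funext => p; rewrite big_ord_recl.
rewrite E; split.
  exact: (rintegrable_tensor (gi ord0) ii).
by rewrite big_ord_recl -ie; exact: (rint_tensor (gi ord0) ii).
Qed.

End Rn.

(** * Approximate identity *)

Section ApproximateIdentity.
Local Open Scope classical_set_scope.
Variables (R : realType) (m : nat).
Local Notation Om := (ms_type (lebRn R m)).
Local Notation rint f := (Rintegral (ms_mu (lebRn R m)) setT f).
Local Notation rintegrable f := ((ms_mu (lebRn R m)).-integrable setT (EFin \o f)).
Implicit Type a : 'I_m -> R.

(* Normalized to have mass [(2 pi) ^+ m]. *)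
Definition gauss_kernel a (n : nat) (p : Om) : R :=
  \prod_(k < m) (Num.sqrt (pi / (4 * n.+1%:R)^-1) * gauss n.+1%:R (Rn_coord p k - a k)).

(** This is the integral of the one-dimensional damping factor [gauss (4 * n.+1%:R)^-1], which
    appears as the amplitude of its transform. *)
Let peak n : R := Num.sqrt (pi / (4 * n.+1%:R)^-1).

Lemma gauss_le1 (a t : R) : 0 <= a -> gauss a t <= 1.
Proof. by move=> a0; rewrite /gauss -expR0 ler_expR oppr_le0 mulr_ge0 ?sqr_ge0. Qed.

(** The dependence on [n] cancels between amplitude and mass; the remaining [2 * pi] per coordinate
    will be offset by two factors [cl_nrm]. *)
Lemma peak_pi n : peak n * Num.sqrt (pi / n.+1%:R) = 2 * pi.
Proof.
rewrite /peak -sqrtrM ?mulr_ge0 ?pi_ge0// ?invr_ge0 ?invrK//.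
rewrite [X in Num.sqrt X](_ : _ = (2 * pi) ^+ 2).
  by rewrite sqrtr_sqr ger0_norm// mulr_ge0 ?pi_ge0.
by field; rewrite nat1r pnatr_eq0.
Qed.

Lemma gauss_kernel_integral a n :
  rintegrable (gauss_kernel a n) /\ rint (gauss_kernel a n) = (2 * pi) ^+ m.
Proof.
have N0 : (0 : R) < n.+1%:R by [].
have gi k : (@lebesgue_measure R).-integrable setT
    (EFin \o (fun t => peak n * gauss n.+1%:R (t - a k))).
  by apply: rintegrableZ; have [] := gauss_shift_integral (a k) N0.
have [i e] := rint_prod_coord gi; split => //.
rewrite e (eq_bigr (fun=> 2 * pi)) ?prodr_const ?card_ord// => k _.
by have [gk ge] := gauss_shift_integral (a k) N0; rewrite rintZ// ge peak_pi.
Qed.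

Lemma gauss_kernel_ge0 a n p : 0 <= gauss_kernel a n p.
Proof. by apply: prodr_ge0 => k _; rewrite mulr_ge0 ?sqrtr_ge0 ?gauss_ge0. Qed.

Lemma gauss_kernel_le a n p : gauss_kernel a n p <= peak n ^+ m.
Proof.
apply: (@le_trans _ _ (\prod_(k < m) peak n)); last by rewrite prodr_const card_ord.
apply: ler_prod => k _; rewrite mulr_ge0 ?sqrtr_ge0 ?gauss_ge0//=.
by rewrite ler_piMr ?sqrtr_ge0// gauss_le1.
Qed.

Lemma rintegrable_gauss_kernel (f : Om -> R) a n : rintegrable f ->
  rintegrable (fun p => f p * gauss_kernel a n p).
Proof.
move=> fi; have mK := rintegrable_measurable (gauss_kernel_integral a n).1.
apply: (le_rintegrable _ _ (rintegrableZ (peak n ^+ m) (rintegrable_norm fi))).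
  by apply: measurable_funM => //; exact: (rintegrable_measurable fi).
move=> p; rewrite normrM mulrC ler_wpM2r//.
by rewrite ger0_norm ?gauss_kernel_ge0 ?gauss_kernel_le.
Qed.

(** With [S] the squared distance to the centre and [N = n.+1], one has [N S >= N d^2 / 2 + S / 2],
    since [S >= d^2] and [N >= 1]. The first term gives smallness in [n], the second a fixed
    integrable Gaussian. *)
Lemma gauss_kernel_tail a n p (d : R) (k : 'I_m) : 0 < d -> d <= `|Rn_coord p k - a k| ->
  gauss_kernel a n p <= peak n ^+ m * gauss (n.+1%:R / 2) d *
    \prod_(k < m) gauss 2^-1 (Rn_coord p k - a k).
Proof.
move=> d0 dk; rewrite /gauss_kernel big_split/= prodr_const card_ord -mulrA.
rewrite ler_wpM2l ?exprn_ge0 ?sqrtr_ge0// /gauss -!expR_sum -expRD ler_expR.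
rewrite !sumrN -opprD lerN2 -!mulr_sumr.
set S := \sum_(_ < _) _.
have dS : d ^+ 2 <= S.
  rewrite /S (bigD1 k)//= -[d ^+ 2]addr0 lerD//; last by rewrite sumr_ge0// => j _; rewrite sqr_ge0.
  by rewrite -[leRHS](real_normK (num_real _)) lerXn2r// nnegrE ltW.
have S0 : 0 <= S by rewrite (le_trans _ dS)// sqr_ge0.
have N1 : 1 <= n.+1%:R :> R by rewrite ler1n.
nra.
Qed.

Lemma peak_gauss_le (d : R) : 0 < d -> exists C : R, forall n,
  peak n ^+ m * gauss (n.+1%:R / 2) d <= C / n.+1%:R.
Proof.
(* This [c] makes [gauss (n.+1%:R / 2) d] the inverse of the [m.+1]-st power of
   [expR (c * n.+1%:R)]. As [expR t >= t], those [m.+1] powers of [n.+1] beat [peak n ^+ m] with one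
   to spare. *)
move=> d0; pose c := d ^+ 2 / 2 / m.+1%:R.
have c0 : 0 < c by rewrite !divr_gt0// exprn_gt0.
exists ((4 * pi) ^+ m / c ^+ m.+1) => n.
have N1 : 1 <= n.+1%:R :> R by rewrite ler1n.
have N0 : 0 < n.+1%:R :> R by [].
have -> : gauss (n.+1%:R / 2) d = (expR (c * n.+1%:R) ^+ m.+1)^-1.
  rewrite /gauss expRN -expRM_natl; congr ((expR _)^-1); rewrite /c.
  by field; rewrite nat1r pnatr_eq0.
(* A square root is at most its argument once the latter is at least [1]; any polynomial bound of
   degree one in [n.+1] serves here. *)
have h1 : peak n <= 4 * pi * n.+1%:R.
  rewrite /peak invrK.
  have h : 1 <= pi * (4 * n.+1%:R) :> R.
    have := pi_ge2 R; nra.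
  rewrite -[leRHS]ger0_norm; last by rewrite !mulr_ge0 ?pi_ge0.
  rewrite -sqrtr_sqr ler_wsqrtr// (_ : 4 * pi * _ = pi * (4 * n.+1%:R)); last by ring.
  by rewrite expr2 ler_peMl// (le_trans ler01).
have h2 : (c * n.+1%:R) ^+ m.+1 <= expR (c * n.+1%:R) ^+ m.+1.
  have cN : 0 <= c * n.+1%:R by rewrite mulr_ge0 ?(ltW c0).
  rewrite lerXn2r ?nnegrE ?expR_ge0// (le_trans _ (expR_ge1Dx _))//.
  by rewrite lerDr.
have cN0 : 0 < (c * n.+1%:R) ^+ m.+1 by rewrite exprn_gt0// mulr_gt0.
apply: (@le_trans _ _ ((4 * pi * n.+1%:R) ^+ m / (c * n.+1%:R) ^+ m.+1)).
  apply: ler_pM; rewrite ?exprn_ge0 ?sqrtr_ge0 ?invr_ge0 ?exprn_ge0 ?expR_ge0//.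
    by rewrite lerXn2r// nnegrE ?sqrtr_ge0// !mulr_ge0 ?pi_ge0.
  by rewrite lef_pV2// posrE// exprn_gt0// expR_gt0.
rewrite !exprMn [n.+1%:R ^+ m.+1]exprSr le_eqVlt; apply/orP; left; apply/eqP.
move: (n.+1%:R) N0 (c ^+ m.+1) (exprn_gt0 m.+1 c0) => N N0' x x0.
have := exprn_gt0 m N0'; move: (N ^+ m) => y y0.
by field; rewrite !gt_eqF ?exprn_gt0 ?invr_gt0.
Qed.

(** Within distance [d] of the centre [f] is close to [v]; farther out the kernel is at most
    [C / n.+1] times a fixed Gaussian, so integrability of [f] suffices there. *)
Lemma gauss_kernel_cvg (f : Om -> R) a (v : R) : rintegrable f ->
  (forall e : R, 0 < e -> exists2 d : R, 0 < d &
     forall p, (forall k : 'I_m, `|Rn_coord p k - a k| < d) -> `|f p - v| <= e) ->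
  rint (fun p => f p * gauss_kernel a n p) @[n --> \oo] --> (2 * pi) ^+ m * v.
Proof.
move=> fi fv.
have fKi n := rintegrable_gauss_kernel a n fi.
pose E (p : Om) := \prod_(k < m) gauss (2^-1 : R) (Rn_coord p k - a k).
have Ei : rintegrable E.
  by have [] := @rint_prod_coord R m (fun k t => gauss 2^-1 (t - a k))
    (fun k => (gauss_shift_integral (a k) (_ : (0 : R) < 2^-1)).1).
have E0 p : 0 <= E p by apply: prodr_ge0 => k _; rewrite gauss_ge0.
have pi0 : (0 : R) < (2 * pi) ^+ m by rewrite exprn_gt0// mulr_gt0 ?pi_gt0.
apply/cvgrPdist_le => e e0.
(* The tolerance is divided by the kernel mass [(2 * pi) ^+ m], so the near part contributes at most
   [e / 2]. *)
have [d d0 fd] := fv (e / 2 / (2 * pi) ^+ m) (divr_gt0 (divr_gt0 e0 (ltr0Sn _ _)) pi0).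
have [C HC] := peak_gauss_le d0.
pose M := rint (fun p => `|f p|) + `|v| * rint E.
have M0 : 0 <= M.
  apply: addr_ge0; first by apply: Rintegral_ge0.
  by apply: mulr_ge0 => //; apply: Rintegral_ge0 => p _; exact: E0.
have bound n : `|(2 * pi) ^+ m * v - rint (fun p => f p * gauss_kernel a n p)| <=
    e / 2 + C / n.+1%:R * M.
  have [Ki Ke] := gauss_kernel_integral a n.
  have di : rintegrable (fun p => (f p - v) * gauss_kernel a n p).
    under [X in _.-integrable _ (_ \o X)]eq_fun do rewrite mulrBl.
    exact: (integrableB measurableT (fKi n) (rintegrableZ v Ki)).
  have -> : (2 * pi) ^+ m * v - rint (fun p => f p * gauss_kernel a n p) =
      - rint (fun p => (f p - v) * gauss_kernel a n p).
    under [in RHS]eq_Rintegral do rewrite mulrBl.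
    rewrite RintegralB//; last exact: rintegrableZ.
    by rewrite rintZ// Ke opprB mulrC.
  rewrite normrN (le_trans (le_normr_Rintegral measurableT di))//.
  (* [B] adds the near and far majorants and dominates everywhere, which avoids splitting the domain
     of integration. *)
  pose B p := e / 2 / (2 * pi) ^+ m * gauss_kernel a n p +
    C / n.+1%:R * (`|f p| + `|v| * E p).
  have i2 : rintegrable (fun p => `|f p| + `|v| * E p).
    by apply: rintegrableD; [exact: rintegrable_norm|exact: rintegrableZ].
  have Bi : rintegrable B by apply: rintegrableD; exact: rintegrableZ.
  have -> : e / 2 + C / n.+1%:R * M = rint B.
    rewrite /B RintegralD//; try exact: rintegrableZ.
    rewrite !rintZ// Ke divfK ?gt_eqF//; congr (_ + _ * _).
    rewrite RintegralD//; [|exact: rintegrable_norm|exact: rintegrableZ].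
    by rewrite rintZ.
  apply: le_Rintegral => //; first exact: rintegrable_norm.
  have C0 : 0 <= C / n.+1%:R.
    by apply: le_trans (HC n); rewrite mulr_ge0 ?exprn_ge0 ?sqrtr_ge0 ?gauss_ge0.
  move=> p _; rewrite normrM (ger0_norm (gauss_kernel_ge0 _ _ _)) /B.
  have [near|/existsNP[k /negP]] := pselect (forall k : 'I_m, `|Rn_coord p k - a k| < d).
    rewrite -[leLHS]addr0 lerD// ?ler_wpM2r ?gauss_kernel_ge0 ?fd//.
    by rewrite mulr_ge0// addr_ge0// mulr_ge0.
  rewrite -leNgt => dk; rewrite -[leLHS]add0r lerD//.
    by rewrite mulr_ge0 ?gauss_kernel_ge0// !divr_ge0// ltW.
  have Kt := gauss_kernel_tail n d0 dk.
  have Kt' : gauss_kernel a n p <= C / n.+1%:R * E p.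
    exact: (le_trans Kt (ler_wpM2r (E0 p) (HC n))).
  (* This turns [|f p| * E p] into [|f p|], whose integral is finite. *)
  have E1 : E p <= 1.
    by apply: prodr_ile1 => j _; rewrite gauss_ge0 gauss_le1// invr_ge0.
  apply: (@le_trans _ _ ((`|f p| + `|v|) * (C / n.+1%:R * E p))).
    by apply: ler_pM => //; rewrite ?gauss_kernel_ge0// ler_normB.
  have := normr_ge0 (f p); have := normr_ge0 v; have := E0 p.
  move: (C / _) C0 (E p) E1 `|f p| `|v| => c c0 z z1 x y z0 y0 x0.
  rewrite (_ : _ * (c * z) = c * (x * z + y * z)); last by ring.
  by rewrite ler_wpM2l// lerD// ler_piMr.
near=> n; rewrite (le_trans (bound n))// [leRHS]splitr lerD//.
rewrite mulrAC ler_pdivrMr//.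
near: n.
exists (Num.truncn (C * M / (e / 2))) => // n /= h.
rewrite [leRHS]mulrC -ler_pdivrMr ?divr_gt0//.
by rewrite (le_trans (ltW (truncnS_gt _)))// ler_nat ltnS.
Unshelve. all: by end_near.
Qed.

End ApproximateIdentity.

(** * Regularized inversion *)

Section Inversion.
Local Open Scope classical_set_scope.
Variables (R : realType) (m : nat) (x y : 'rV[R]_m).
Local Notation Om := (ms_type (lebRn R m)).
Local Notation rint f := (Rintegral (ms_mu (lebRn R m)) setT f).
Local Notation rintegrable f := ((ms_mu (lebRn R m)).-integrable setT (EFin \o f)).
Local Notation idx := {ffun 'I_4 * 'I_m -> bool}.
Implicit Type J : idx.

Let damp (n : nat) (u : Om) : R := \prod_(k < m) gauss (4 * n.+1%:R)^-1 (Rn_coord u k).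

Lemma Rm_ptE (p : Om) k : Rm_pt p 0 k = Rn_coord p k.
Proof. by rewrite mxE. Qed.

Lemma norm_trigprod_le1 J (a b c d : 'rV[R]_m) : `|trigprod J a b c d| <= 1.
Proof.
rewrite normr_prod; apply: prodr_ile1 => k _; rewrite normr_ge0 !normrM/=.
by rewrite !mulr_ile1 ?mulr_ge0 ?norm_trig_le1.
Qed.

Lemma measurable_Rm_pt k : measurable_fun setT (fun p : Om => Rm_pt p 0 k).
Proof. by under eq_fun do rewrite Rm_ptE; exact: measurable_Rn_coord. Qed.

Lemma measurable_trigprod J d (T : measurableType d) (a b c u : T -> 'rV[R]_m) :
  (forall k, measurable_fun setT (fun t => a t 0 k)) ->
  (forall k, measurable_fun setT (fun t => b t 0 k)) ->
  (forall k, measurable_fun setT (fun t => c t 0 k)) ->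
  (forall k, measurable_fun setT (fun t => u t 0 k)) ->
  measurable_fun setT (fun t => trigprod J (a t) (b t) (c t) (u t)).
Proof.
move=> ma mb mc mu; apply: measurable_prod => k _.
have mtrig s : measurable_fun setT (@trig R s).
  by apply: continuous_measurable_fun; exact: continuous_trig.
have mt s (v : T -> R) : measurable_fun setT v ->
    measurable_fun setT (fun t => trig s (v t * u t 0 k)).
  by move=> mv; exact: (measurableT_comp (mtrig s) (measurable_funM mv (mu k))).
exact: (measurable_funM (measurable_funM (mt _ _ (ma k)) (mt _ _ (mb k))) (mt _ _ (mc k))).
Qed.

(** Balls of row vectors are entrywise, so continuity delivers the coordinatewise hypothesis of
    [gauss_kernel_cvg]. *)
Lemma coord_continuity (g : 'rV[R]_m -> R) (w : 'rV[R]_m) : continuous g ->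
  forall e : R, 0 < e -> exists2 d : R, 0 < d &
    forall p : Om, (forall k : 'I_m, `|Rn_coord p k - w 0 k| < d) ->
      `|g (Rm_pt p) - g w| <= e.
Proof.
move=> cg e e0.
have /cvgrPdist_le/(_ e e0) := cg w.
move=> /nbhs_ballP[d d0 H]; exists d => // p Hp.
rewrite distrC; apply: H; split => // i k.
by rewrite ord1 /ball/= mxE distrC.
Qed.

Lemma damp_integrable n : rintegrable (damp n).
Proof.
have a0 : (0 : R) < (4 * n.+1%:R)^-1 by rewrite invr_gt0 mulr_gt0.
by have [] := @rint_prod_coord R m (fun _ => gauss (4 * n.+1%:R)^-1)
  (fun k => (gauss_integral a0).1).
Qed.

Lemma damp_ge0 n u : 0 <= damp n u.
Proof. by apply: prodr_ge0 => k _; exact: gauss_ge0. Qed.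

Lemma damp_le1 n u : damp n u <= 1.
Proof. by apply: prodr_ile1 => k _; rewrite gauss_ge0 gauss_le1// invr_ge0 mulr_ge0. Qed.

Lemma damp_cvg u : damp n u @[n --> \oo] --> (1 : R).
Proof.
have E n : damp n u = expR (- ((n.+1%:R)^-1 * (4^-1 * \sum_(k < m) Rn_coord u k ^+ 2))).
  rewrite /damp /gauss -expR_sum sumrN -mulr_sumr; congr (expR (- _)).
  by rewrite invfM mulrA [_ * 4^-1]mulrC.
under eq_fun do rewrite E.
have lim0 (c : R) : - (n.+1%:R^-1 * c) @[n --> \oo] --> (0 : R).
  have : - (n.+1%:R^-1 * c) @[n --> \oo] --> - (0 * c).
    by apply: cvgN; apply: cvgM; [exact: cvg_harmonic|exact: cvg_cst].
  by rewrite mul0r oppr0.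
suff : expR (- (n.+1%:R^-1 * (4^-1 * \sum_(k < m) Rn_coord u k ^+ 2)))
    @[n --> \oo] --> expR (0 : R) by rewrite expR0.
by apply: continuous_cvg; [exact: continuous_expR|exact: lim0].
Qed.

Lemma cvg_sumr (I : Type) (r : seq I) (Q : pred I) (F : I -> nat -> R) (l : I -> R) :
  (forall k, Q k -> F k n @[n --> \oo] --> l k) ->
  \sum_(k <- r | Q k) F k n @[n --> \oo] --> \sum_(k <- r | Q k) l k.
Proof. by move=> Fl; apply: cvg_big => //; exact: add_continuous. Qed.

(** The value of [f] at this point is [f^gam (x - y^phi)]. *)
Definition node (phi gam : {ffun 'I_m -> bool}) : 'rV[R]_m :=
  crefl gam (x - crefl phi y).

(** The integrand factors over the coordinates, so the integral is a product of those computed in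
    [rint_trig3]. *)
Lemma damp_trigprod n J (z : Om) :
  rint (fun u => trigprod J x y (Rm_pt z) (Rm_pt u) * damp n u) =
  [forall k, ~~ odd (jsum J k)]%:R * ((4 ^+ m)^-1 *
  \sum_(phi : {ffun 'I_m -> bool}) \sum_(gam : {ffun 'I_m -> bool})
    (\prod_(k < m) trig_sign R (jent J 1 k) (jent J 2 k) (jent J 3 k) (phi k) (gam k)) *
    gauss_kernel (fun k => node phi gam 0 k) n z).
Proof.
have a0 : (0 : R) < (4 * n.+1%:R)^-1 by rewrite invr_gt0 mulr_gt0.
have aN : (4 * (4 * n.+1%:R)^-1)^-1 = n.+1%:R :> R by rewrite invfM invrK mulKf.
pose h k t := trig (jent J 1 k) (x 0 k * t) * trig (jent J 2 k) (y 0 k * t) *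
  trig (jent J 3 k) (Rn_coord z k * t) * gauss (4 * n.+1%:R)^-1 t.
have hi k : (@lebesgue_measure R).-integrable setT (EFin \o h k).
  have mtrig b c : measurable_fun setT (fun t : R => trig b (c * t)).
    apply: continuous_measurable_fun => t; apply: continuous_comp.
      by apply: cvgM; [exact: cvg_cst|exact: cvg_id].
    exact: continuous_trig.
  apply: (le_rintegrable _ _ (gauss_integral a0).1).
    apply: measurable_funM; last first.
      by apply: continuous_measurable_fun; exact: continuous_gauss.
    exact: (measurable_funM (measurable_funM (mtrig _ _) (mtrig _ _)) (mtrig _ _)).
  move=> t; rewrite normrM (ger0_norm (gauss_ge0 _ _)) ler_piMl ?gauss_ge0//.
  by rewrite !normrM !mulr_ile1 ?mulr_ge0 ?norm_trig_le1.
have [_ e] := rint_prod_coord hi.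
rewrite (_ : (fun u => _) = fun u => \prod_(k < m) h k (Rn_coord u k)); last first.
  apply/funext => u; rewrite -big_split/=; apply: eq_bigr => k _.
  by rewrite !Rm_ptE.
rewrite e /h.
pose P := Num.sqrt (pi / (4 * n.+1%:R)^-1) : R.
pose s k phi gam := trig_sign R (jent J 1 k) (jent J 2 k) (jent J 3 k) phi gam.
pose w k (phi gam : bool) := (-1) ^+ gam * (x 0 k - (-1) ^+ phi * y 0 k).
rewrite (eq_bigr (fun k => (~~ odd (jsum J k))%:R * (4^-1 *
   \sum_(phi : bool) \sum_(gam : bool)
     s k phi gam * (P * gauss n.+1%:R (Rn_coord z k - w k phi gam))))); last first.
  move=> k _; rewrite rint_trig3// aN -!mulrA; congr (_ * _).
  rewrite mulrCA; congr (_ * _); rewrite mulr_sumr; apply: eq_bigr => phi _.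
  by rewrite mulr_sumr; apply: eq_bigr => gam _; rewrite mulrCA.
rewrite big_split/= big_split/= prodr_const card_ord exprVn; congr (_ * (_ * _)).
  (* One coordinate with an odd number of sines annihilates the whole product. *)
  case: (boolP [forall k, _]) => [/forallP H|].
    by rewrite big1// => k _; rewrite H.
  rewrite negb_forall => /existsP[k]; rewrite negbK => H.
  by rewrite (bigD1 k)//= H mul0r.
(* Expanding the product of sums, two bits chosen per coordinate become the functions [phi] and
   [gam]. *)
rewrite bigA_distr_bigA/=; apply: eq_bigr => phi _.
rewrite bigA_distr_bigA/=; apply: eq_bigr => gam _.
rewrite big_split/=; congr (_ * _); apply: eq_bigr => k _.
by rewrite /w /node !mxE.
Qed.

(** The damped integrals have two limits to compare: dominated convergence with majorant [|Q|] gives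
    the left-hand side, Fubini and the approximate identities give the right-hand side. *)
Lemma regularized_inversion (P : pred idx) (g : idx -> 'rV[R]_m -> R) :
  (forall J, P J -> continuous (g J)) ->
  (forall J, P J -> rintegrable (fun p => g J (Rm_pt p))) ->
  rintegrable (fun u => rint (fun z =>
    \sum_(J | P J) trigprod J x y (Rm_pt z) (Rm_pt u) * g J (Rm_pt z))) ->
  rint (fun u => rint (fun z =>
    \sum_(J | P J) trigprod J x y (Rm_pt z) (Rm_pt u) * g J (Rm_pt z))) =
  (2 * pi) ^+ m * ((4 ^+ m)^-1 *
   \sum_(J | P J && [forall k, ~~ odd (jsum J k)])
     \sum_(phi : {ffun 'I_m -> bool}) \sum_(gam : {ffun 'I_m -> bool})
      (\prod_(k < m) trig_sign R (jent J 1 k) (jent J 2 k) (jent J 3 k) (phi k) (gam k)) *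
      g J (node phi gam)).
Proof.
move=> cg gi; set Q := (X in rintegrable X) => Qi.
have lim1 : rint (fun u => Q u * damp n u) @[n --> \oo] --> rint Q.
  apply: (rint_dominated_cvg _ _ (rintegrable_norm Qi)).
  - move=> n; apply: measurable_funM; first exact: (rintegrable_measurable Qi).
    exact: (rintegrable_measurable (damp_integrable n)).
  - move=> u; rewrite -[X in _ --> X]mulr1.
    by apply: cvgM; [exact: cvg_cst|exact: damp_cvg].
  - move=> n u; rewrite normrM ler_piMr// ger0_norm ?damp_ge0//.
    exact: damp_le1.
have E n : rint (fun u => Q u * damp n u) = (4 ^+ m)^-1 *
   \sum_(J | P J && [forall k, ~~ odd (jsum J k)])
     \sum_(phi : {ffun 'I_m -> bool}) \sum_(gam : {ffun 'I_m -> bool})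
      (\prod_(k < m) trig_sign R (jent J 1 k) (jent J 2 k) (jent J 3 k) (phi k) (gam k)) *
      rint (fun z => g J (Rm_pt z) * gauss_kernel (fun k => node phi gam 0 k) n z).
  pose F (q : Om * Om) := damp n q.1 *
    \sum_(J | P J) trigprod J x y (Rm_pt q.2) (Rm_pt q.1) * g J (Rm_pt q.2).
  have ti J (u : Om) : P J ->
      rintegrable (fun z => trigprod J x y (Rm_pt z) (Rm_pt u) * g J (Rm_pt z)).
    move=> PJ; apply: (le_rintegrable _ _ (rintegrable_norm (gi J PJ))).
      apply: measurable_funM; last exact: (rintegrable_measurable (gi J PJ)).
      by apply: measurable_trigprod => k; try exact: measurable_cst; exact: measurable_Rm_pt.
    by move=> z; rewrite normrM ler_piMl// norm_trigprod_le1.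
  have -> : rint (fun u => Q u * damp n u) = rint (fun u => rint (fun z => F (u, z))).
    apply: eq_Rintegral => u _; rewrite /F/= rintZ; first by rewrite mulrC.
    by apply: rintegrable_sum => J PJ; exact: ti.
  have mF : measurable_fun setT F.
    apply: measurable_funM.
      exact: (measurableT_comp (rintegrable_measurable (damp_integrable n)) measurable_fst).
    under eq_fun do rewrite big_mkcond/=.
    apply: measurable_sum => J; case: (boolP (P J)) => PJ; last exact: measurable_cst.
    apply: measurable_funM.
      apply: measurable_trigprod => k; try exact: measurable_cst.
        exact: (measurableT_comp (measurable_Rm_pt k) measurable_snd).
      exact: (measurableT_comp (measurable_Rm_pt k) measurable_fst).
    exact: (measurableT_comp (rintegrable_measurable (gi J PJ)) measurable_snd).
  have bi : rintegrable (fun z => \sum_(J | P J) `|g J (Rm_pt z)|).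
    by apply: rintegrable_sum => J PJ; exact: (rintegrable_norm (gi J PJ)).
  (* [trigprod] is bounded but has no decay in [u]; the damping supplies it and yields the product
     majorant needed for Fubini. *)
  have Fle u z : `|F (u, z)| <= damp n u * \sum_(J | P J) `|g J (Rm_pt z)|.
    rewrite /F/= normrM (ger0_norm (damp_ge0 _ _)) ler_wpM2l ?damp_ge0//.
    apply: (le_trans (ler_norm_sum _ _ _)); apply: ler_sum => J _.
    by rewrite normrM ler_piMl// norm_trigprod_le1.
  rewrite (rint_Fubini mF Fle (damp_integrable n) bi).
  have gKi J phi gam : P J ->
      rintegrable (fun z => g J (Rm_pt z) * gauss_kernel (fun k => node phi gam 0 k) n z).
    by move=> PJ; exact: rintegrable_gauss_kernel (gi J PJ).
  have E2 z : rint (fun u => F (u, z)) = \sum_(J | P J && [forall k, ~~ odd (jsum J k)])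
     (4 ^+ m)^-1 * (\sum_(phi : {ffun 'I_m -> bool}) \sum_(gam : {ffun 'I_m -> bool})
      (\prod_(k < m) trig_sign R (jent J 1 k) (jent J 2 k) (jent J 3 k) (phi k) (gam k)) *
      (g J (Rm_pt z) * gauss_kernel (fun k => node phi gam 0 k) n z)).
    have ki J : rintegrable (fun u => trigprod J x y (Rm_pt z) (Rm_pt u) * damp n u).
      apply: (le_rintegrable _ _ (damp_integrable n)).
        apply: measurable_funM; last exact: (rintegrable_measurable (damp_integrable n)).
        by apply: measurable_trigprod => k; try exact: measurable_cst; exact: measurable_Rm_pt.
      move=> u; rewrite normrM (ger0_norm (damp_ge0 _ _)) ler_piMl ?damp_ge0//.
      exact: norm_trigprod_le1.
    transitivity (rint (fun u => \sum_(J | P J)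
        g J (Rm_pt z) * (trigprod J x y (Rm_pt z) (Rm_pt u) * damp n u))).
      apply: eq_Rintegral => u _; rewrite /F/= mulr_sumr; apply: eq_bigr => J _.
      by ring.
    rewrite rint_sum; last by move=> J _; exact: rintegrableZ.
    rewrite big_mkcondr/=; apply: eq_bigr => J PJ; rewrite rintZ//.
    rewrite damp_trigprod; case: ifP => _; last by rewrite mul0r mulr0.
    rewrite mul1r mulrCA; congr (_ * _); rewrite mulr_sumr; apply: eq_bigr => phi _.
    by rewrite mulr_sumr; apply: eq_bigr => gam _; rewrite mulrCA.
  under eq_Rintegral do rewrite E2.
  have si J (phi : {ffun 'I_m -> bool}) : P J ->
    rintegrable (fun z => \sum_(gam : {ffun 'I_m -> bool})
      (\prod_(k < m) trig_sign R (jent J 1 k) (jent J 2 k) (jent J 3 k) (phi k) (gam k)) *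
      (g J (Rm_pt z) * gauss_kernel (fun k => node phi gam 0 k) n z)).
    by move=> PJ; apply: rintegrable_sum => gam _; apply: rintegrableZ; exact: gKi.
  rewrite rint_sum; last first.
    move=> J /andP[PJ _]; apply: rintegrableZ; apply: rintegrable_sum => phi _.
    exact: si.
  rewrite mulr_sumr; apply: eq_bigr => J /andP[PJ _].
  rewrite rintZ; last by apply: rintegrable_sum => phi _; exact: si.
  congr (_ * _); rewrite rint_sum; last by move=> phi _; exact: si.
  apply: eq_bigr => phi _; rewrite rint_sum.
    by apply: eq_bigr => gam _; rewrite rintZ//; exact: gKi.
  by move=> gam _; apply: rintegrableZ; exact: gKi.
rewrite (funext E) in lim1; apply: (cvg_unique _ lim1) => {lim1} //.
rewrite mulrCA; apply: cvgM; first exact: cvg_cst.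
rewrite mulr_sumr; apply: cvg_sumr => J /andP[PJ _].
rewrite mulr_sumr; apply: cvg_sumr => phi _.
rewrite mulr_sumr; apply: cvg_sumr => gam _.
rewrite mulrCA; apply: cvgM; first exact: cvg_cst.
apply: gauss_kernel_cvg; first exact: gi.
exact: coord_continuity (cg J PJ).
Qed.

End Inversion.

(** * The translation formula *)

Section Assembly.
Local Open Scope classical_set_scope.
Variables (R : realType) (m : nat).
Local Notation Cl := {ffun {set 'I_m} -> R}.
Local Notation Om := (ms_type (lebRn R m)).
Local Notation rint f := (Rintegral (ms_mu (lebRn R m)) setT f).
Local Notation rintegrable f := ((ms_mu (lebRn R m)).-integrable setT (EFin \o f)).

(** Three bits sum to at most [3], so lying in [{0, 2}] is evenness, the parity condition left by
    the integrals. *)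
Lemma inJE (j : {ffun 'I_4 * 'I_m -> bool}) : inJ j =
  [forall k, ~~ jent j 4 k] && [forall k, ~~ odd (jsum j k)].
Proof.
have E k : (jsum j k \in [:: 0; 2]%N) = ~~ odd (jsum j k).
  by rewrite /jsum; case: (jent j 1 k) (jent j 2 k) (jent j 3 k) => [] [] [].
apply/forallP/andP => [H|[/forallP H1 /forallP H2] k]; last by rewrite E H1 H2.
by split; apply/forallP => k; have /andP[] := H k; rewrite ?E.
Qed.

(** When one of the three bits is set the exponent is [-(j + 1)], so the sign is opposite to
    [(-1)^j]. The index [2 phi + gam + 1] runs through the four rows, and the fourth is zero. *)
Lemma ccoefE (j : {ffun 'I_4 * 'I_m -> bool}) (phi gam : {ffun 'I_m -> bool}) :
  inJ j -> ccoef R j phi gam = \prod_(k < m)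
    trig_sign R (jent j 1 k) (jent j 2 k) (jent j 3 k) (phi k) (gam k).
Proof.
move=> /forallP H; apply: eq_bigr => k _; have /andP[_ /negbTE j4] := H k.
have e0 : (-1 : R) ^ (- (1 : int)) = -1 by rewrite -exprnN expr1 invrN1.
have e1 : (-1 : R) ^ (- (2 : int)) = 1 by rewrite -exprnN expr2 mulN1r opprK invr1.
rewrite /trig_sign /jsum; case: (phi k); case: (gam k); rewrite /= ?j4;
  case: (jent j 1 k); case: (jent j 2 k); case: (jent j 3 k);
  rewrite /kdelta/= ?subrr ?mulr0 ?expr0z ?sub0r ?mulrN1 ?add0r ?expr0 ?expr1 ?e0//.
Qed.

Lemma linear_coord (T : Cl -> Cl) (v : Cl) A :
  {morph T : v w / v + w} -> (forall c, {morph T : v / c *: v}) ->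
  T v A = \sum_B v B * T (clbasis R B) A.
Proof.
move=> TD TZ; have T0 : T 0 = 0 by have := TZ 0 0; rewrite !scale0r.
rewrite {1}(clbasis_sum v) (big_morph T TD T0) sum_ffunE.
by apply: eq_bigr => B _; rewrite TZ ffunE.
Qed.

Lemma sandwichD (a b : Cl) : {morph (fun v => sandwich a v b) : v w / v + w}.
Proof. by move=> v w; rewrite /sandwich clmulDr clmulDl. Qed.

Lemma sandwichZ (a b : Cl) c : {morph (fun v => sandwich a v b) : v / c *: v}.
Proof. by move=> v; rewrite /sandwich clmulZr clmulZl. Qed.

Lemma linear_integrable (T : Cl -> Cl) (g : 'rV[R]_m -> Cl) A :
  {morph T : v w / v + w} -> (forall c, {morph T : v / c *: v}) ->
  cl_integrable g -> rintegrable (fun p => T (g (Rm_pt p)) A).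
Proof.
move=> TD TZ gi; under [X in _.-integrable _ (_ \o X)]eq_fun do rewrite linear_coord//.
apply: rintegrable_sum => B _.
under [X in _.-integrable _ (_ \o X)]eq_fun do rewrite mulrC.
exact: rintegrableZ (gi B).
Qed.

(** Each coordinate of [T] is a finite linear combination of coordinates. This moves the
    exponentials in [x] and [y] inside the integral over [z]. *)
Lemma linear_clint (T : Cl -> Cl) (g : 'rV[R]_m -> Cl) A :
  {morph T : v w / v + w} -> (forall c, {morph T : v / c *: v}) ->
  cl_integrable g -> T (clint g) A = rint (fun p => T (g (Rm_pt p)) A).
Proof.
move=> TD TZ gi; rewrite linear_coord//; under [in RHS]eq_Rintegral do rewrite linear_coord//.
have gi' B : rintegrable (fun p => T (clbasis R B) A * g (Rm_pt p) B).
  exact: rintegrableZ (gi B).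
rewrite rint_sum.
  by apply: eq_bigr => B _; rewrite ffunE -RintegralZr//; exact: gi.
move=> B _; under [X in _.-integrable _ (_ \o X)]eq_fun do rewrite mulrC.
exact: gi'.
Qed.

(** * The iterated transform in coordinates *)

Variables (i : 'I_m -> Cl) (mu : nat).

Let allowed (J : {ffun 'I_4 * 'I_m -> bool}) := [forall k, ~~ jent J 4 k].

(** A zero argument makes a family of exponentials trivial, so the triple expansion also serves for
    fewer families. *)
Lemma expprod0l s c (u : 'rV[R]_m) : expprod i s c 0 u = clone R m.
Proof.
rewrite /expprod /clprod; elim: s => //= k s ->.
by rewrite clmul1r /clexp mxE mul0r mulr0 cos0 sin0 scale1r scale0r addr0.
Qed.

Lemma sandwich1 v : sandwich (clone R m) v (clone R m) = v.
Proof. by rewrite /sandwich clmul1l clmul1r. Qed.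

Variable f : 'rV[R]_m -> Cl.
Hypothesis fi : cl_integrable f.
Hypothesis fc : forall A, continuous (fun z : 'rV[R]_m => f z A).

Let term A (J : {ffun 'I_4 * 'I_m -> bool}) (z : 'rV[R]_m) : R :=
  sandwich (lfactor i mu J) (f z) (rfactor i mu J) A.

Let term_integrable A J : rintegrable (fun p => term A J (Rm_pt p)).
Proof. exact: (linear_integrable A (@sandwichD _ _) (@sandwichZ _ _) fi). Qed.

Let term_continuous A J : continuous (term A J).
Proof.
have -> : term A J = fun z => \sum_B f z B *
    sandwich (lfactor i mu J) (clbasis R B) (rfactor i mu J) A.
  apply/funext => z.
  exact: (linear_coord _ A (@sandwichD _ _) (@sandwichZ _ _)).
apply: continuous_big => [|B _ z]; first exact: add_continuous.
by apply: continuousM; [exact: fc|exact: cst_continuous].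
Qed.

(* [sandwich_expprod] at [x = y = 0] expands the inner exponentials alone. *)
Let kernel_integrable u : cl_integrable (fun z =>
  sandwich (expprod i (idxF1 m mu) (-1) z u) (f z) (expprod i (idxF2 m mu) (-1) z u)).
Proof.
move=> A; have E z :
   sandwich (expprod i (idxF1 m mu) (-1) z u) (f z) (expprod i (idxF2 m mu) (-1) z u) A =
   \sum_(J | allowed J) trigprod J 0 0 z u * term A J z.
  have := sandwich_expprod mu i 0 0 z u (f z); rewrite !expprod0l !sandwich1 => ->.
  by rewrite sum_ffunE; apply: eq_bigr => J _; rewrite ffunE.
under [X in _.-integrable _ X]eq_fun do rewrite E.
apply: rintegrable_sum => J _.
apply: (le_rintegrable _ _ (rintegrable_norm (term_integrable A J))).
  apply: measurable_funM; last exact: (rintegrable_measurable (term_integrable A J)).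
  by apply: measurable_trigprod => k; try exact: measurable_cst; exact: measurable_Rm_pt.
by move=> z; rewrite normrM ler_piMl// norm_trigprod_le1.
Qed.

Variables x y : 'rV[R]_m.

Let outer (u : 'rV[R]_m) (v : Cl) : Cl :=
  sandwich (expprod i (rev (idxF1 m mu)) 1 x u)
   (sandwich (expprod i (idxF1 m mu) (-1) y u) v (expprod i (idxF2 m mu) (-1) y u))
  (expprod i (rev (idxF2 m mu)) 1 x u).

Let outerD u : {morph outer u : v w / v + w}.
Proof. by move=> v w; rewrite /outer !sandwichD. Qed.

Let outerZ u c : {morph outer u : v / c *: v}.
Proof. by move=> v; rewrite /outer !sandwichZ. Qed.

Let outer_GFT u A : outer u (GFT i mu f u) A = cl_nrm R m *
  rint (fun z => \sum_(J | allowed J) trigprod J x y (Rm_pt z) u * term A J (Rm_pt z)).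
Proof.
rewrite /GFT outerZ ffunE; congr (_ * _).
rewrite (linear_clint _ (outerD u) (outerZ u) (kernel_integrable u)).
apply: eq_Rintegral => z _; rewrite /outer sandwich_expprod sum_ffunE.
by apply: eq_bigr => J _; rewrite ffunE.
Qed.

(** The matrix entries of [outer u] are bounded uniformly in [u] by the sum of the [|M J|], so
    integrability of the transform carries over. *)
Let outer_GFT_integrable A : cl_integrable (GFT i mu f) ->
  rintegrable (fun u => outer (Rm_pt u) (GFT i mu f (Rm_pt u)) A).
Proof.
move=> Gi; under [X in _.-integrable _ (_ \o X)]eq_fun do rewrite linear_coord//.
apply: rintegrable_sum => B _.
pose M J := sandwich (lfactor i mu J) (clbasis R B) (rfactor i mu J) A.
(* At [z = 0] only the two outer families of exponentials remain. *)
have E u : outer u (clbasis R B) A = \sum_(J | allowed J) trigprod J x y 0 u * M J.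
  have := sandwich_expprod mu i x y 0 u (clbasis R B); rewrite !expprod0l !sandwich1.
  by rewrite -/(outer u _) => ->; rewrite sum_ffunE; apply: eq_bigr => J _; rewrite ffunE.
have mG := rintegrable_measurable (Gi B).
apply: (le_rintegrable _ _ (rintegrableZ (\sum_(J | allowed J) `|M J|)
  (rintegrable_norm (Gi B)))).
  apply: measurable_funM => //; under eq_fun do rewrite E big_mkcond/=.
  apply: measurable_sum => J; case: (boolP (allowed J)) => _; last exact: measurable_cst.
  apply: measurable_funM; last exact: measurable_cst.
  by apply: measurable_trigprod => k; try exact: measurable_cst; exact: measurable_Rm_pt.
move=> u; rewrite E normrM mulrC ler_wpM2r//.
apply: (le_trans (ler_norm_sum _ _ _)); apply: ler_sum => J _.
by rewrite normrM ler_piMl// norm_trigprod_le1.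
Qed.

Lemma cl_nrm_sqr : cl_nrm R m * (cl_nrm R m * (2 * pi) ^+ m) = 1.
Proof.
have p0 : (0 : R) < 2 * pi by rewrite mulr_gt0 ?pi_gt0.
rewrite mulrA /cl_nrm -!exprMn -[X in _ * X](sqr_sqrtr (ltW p0)) expr2.
rewrite mulrACA mulVf ?mulr1 ?expr1n// gt_eqF// sqrtr_gt0//.
Qed.

Lemma gtrans_coord A : cl_integrable (GFT i mu f) ->
  gtrans i mu y f x A = (4 ^+ m)^-1 * \sum_(J | inJ J)
    \sum_(phi : {ffun 'I_m -> bool}) \sum_(gam : {ffun 'I_m -> bool})
      ccoef R J phi gam * term A J (crefl gam (x - crefl phi y)).
Proof.
move=> Gi; have nrm0 : cl_nrm R m != 0.
  apply/eqP => n0; have := cl_nrm_sqr; rewrite n0 mul0r => /esym/eqP.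
  by rewrite oner_eq0.
have Hi := outer_GFT_integrable A Gi.
rewrite /gtrans /IGFT !ffunE.
(* By conversion, the integrand of the inverse transform is [outer] applied to the forward
   transform. *)
rewrite -[X in _ *: X]/(rint (fun u => outer (Rm_pt u) (GFT i mu f (Rm_pt u)) A)).
pose Q u := rint (fun z => \sum_(J | allowed J)
  trigprod J x y (Rm_pt z) (Rm_pt u) * term A J (Rm_pt z)).
have Qi : rintegrable Q.
  have -> : Q = fun u => (cl_nrm R m)^-1 * outer (Rm_pt u) (GFT i mu f (Rm_pt u)) A.
    by apply/funext => u; rewrite outer_GFT mulKf.
  exact: rintegrableZ.
under eq_Rintegral do rewrite outer_GFT.
rewrite rintZ//.
rewrite [X in _ *: (_ * X)](regularized_inversion (fun J _ => @term_continuous A J)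
  (fun J _ => term_integrable A J) Qi).
(* The forward and the inverse transform contribute one [cl_nrm] each, and together these cancel
   [(2 * pi) ^+ m]. *)
rewrite -[LHS]/(cl_nrm R m * (cl_nrm R m * ((2 * pi) ^+ m * _))).
rewrite [cl_nrm R m * ((2 * pi) ^+ m * _)]mulrA mulrA cl_nrm_sqr mul1r.
congr (_ * _); apply: eq_big => [J|J]; first by rewrite inJE.
rewrite -inJE => HJ; apply: eq_bigr => phi _; apply: eq_bigr => gam _.
by rewrite ccoefE.
Qed.

End Assembly.

(** Integrability of [f] and of its transform makes both integrals absolutely convergent; continuity
    makes the approximate identities converge at every single node. *)
Theorem theorem9 (R : realType) (m mu : nat)
    (i : 'I_m -> {ffun {set 'I_m} -> R})
    (f : 'rV[R]_m -> {ffun {set 'I_m} -> R})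
    (y x : 'rV[R]_m) :
  (forall k, clmul (i k) (i k) = - clone R m) ->
  (mu <= m)%N ->
  (forall A, continuous (fun z : 'rV[R]_m => f z A)) ->
  cl_integrable f ->
  cl_integrable (GFT i mu f) ->
  gtrans i mu y f x =
    (4 ^+ m)^-1 *:
      \sum_(j : {ffun 'I_4 * 'I_m -> bool} | inJ j)
        \sum_(phi : {ffun 'I_m -> bool}) \sum_(gam : {ffun 'I_m -> bool})
          ccoef R j phi gam *:
            clmul (clmul (lfactor i mu j) (f (crefl gam (x - crefl phi y))))
                  (rfactor i mu j).
Proof.
move=> _ _ fc fi Gi; apply/ffunP => A.
rewrite (gtrans_coord fi fc x y A Gi) ffunE sum_ffunE; congr (_ * _).
apply: eq_bigr => J _; rewrite sum_ffunE; apply: eq_bigr => phi _.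
by rewrite sum_ffunE; apply: eq_bigr => gam _; rewrite ffunE.
Qed.
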